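(* Let $E$ be a countable directed graph and let $A$ be a $C^*$-algebra that is generated, as a $C^*$-algebra, by a Cuntz-Krieger $E$-family. Then $A$ is singly generated, i.e. there is an element $x\in A$ such that the smallest $C^*$-subalgebra of $A$ containing $x$ is $A$ itself.
   Context: A directed graph $E=(E^0,E^1,r,s)$ consists of countable (finite or countably infinite) sets $E^0$ (vertices) and $E^1$ (edges) and maps $r,s\colon E^1\to E^0$ (range and source). A Cuntz-Krieger $E$-family in a $C^*$-algebra $A$ consists of mutually orthogonal projections $\{p_v : v\in E^0\}\subseteq A$ and partial isometries $\{s_e : e\in E^1\}\subseteq A$ with mutually orthogonal ranges such that (i) $s_e^*s_e=p_{s(e)}$ for all $e\in E^1$; (ii) $s_es_e^*\le p_{r(e)}$ for all $e\in E^1$; (iii) $p_v=\sum_{r(e)=v}s_es_e^*$ whenever $0<|r^{-1}(v)|<\infty$. $C^*$-algebras are not assumed unital, and generation is in the sense of (not necessarily unital) $C^*$-algebras. *)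

(* Defs.v *)
From HB Require Import structures.
From mathcomp Require Import all_boot all_order all_algebra complex.
From mathcomp Require Import all_classical all_reals all_analysis.

Set Implicit Arguments.
Unset Strict Implicit.
Unset Printing Implicit Defensive.

Import Order.TTheory GRing.Theory Num.Theory.
Import numFieldNormedType.Exports.

Local Open Scope classical_set_scope.
Local Open Scope ring_scope.

Declare Scope cstar_scope.
Delimit Scope cstar_scope with cstar.

(* Not assumed unital, hence a multiplication of its own: the ring structures
   of MathComp all have a unit.  The norm takes its values in the nonnegative
   reals of R[i]. *)
HB.mixin Record isCstarAlgebra (R : realType) A
    of CompleteNormedModule R[i] A := {
  cmul : A -> A -> A;
  cstar : A -> A;
  cmulA : forall x y z : A, cmul x (cmul y z) = cmul (cmul x y) z;
  cmulDl : forall x y z : A, cmul (x + y) z = cmul x z + cmul y z;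
  cmulDr : forall x y z : A, cmul x (y + z) = cmul x y + cmul x z;
  cmulZl : forall (a : R[i]) (x y : A), cmul (a *: x) y = a *: cmul x y;
  cmulZr : forall (a : R[i]) (x y : A), cmul x (a *: y) = a *: cmul x y;
  cstarK : forall x : A, cstar (cstar x) = x;
  cstarD : forall x y : A, cstar (x + y) = cstar x + cstar y;
  cstarZ : forall (a : R[i]) (x : A), cstar (a *: x) = conjc a *: cstar x;
  cstarM : forall x y : A, cstar (cmul x y) = cmul (cstar y) (cstar x);
  cnormM : forall x y : A, `|cmul x y| <= `|x| * `|y|;
  cnorm_star : forall x : A, `|cmul (cstar x) x| = `|x| ^+ 2
}.

#[short(type="cstarAlgType")]
HB.structure Definition CstarAlgebra (R : realType) :=
  {A of isCstarAlgebra R A & CompleteNormedModule R[i] A}.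

Notation "x '**' y" := (cmul x y)
  (at level 40, left associativity) : cstar_scope.
Notation "x ^*" := (cstar x) : cstar_scope.
Local Open Scope cstar_scope.

Definition projection (R : realType) (A : cstarAlgType R) (p : A) : Prop :=
  p ** p = p /\ p^* = p.

Definition partial_isometry (R : realType) (A : cstarAlgType R) (s : A) : Prop :=
  s ** s^* ** s = s.

Definition cpositive (R : realType) (A : cstarAlgType R) (a : A) : Prop :=
  exists c : A, a = c^* ** c.

Definition cle (R : realType) (A : cstarAlgType R) (a b : A) : Prop :=
  cpositive (b - a).

Definition cstar_subalgebra (R : realType) (A : cstarAlgType R) (B : set A) : Prop :=
  [/\ B 0 /\ (forall x y, B x -> B y -> B (x + y)),
      forall (a : R[i]) x, B x -> B (a *: x),
      forall x y, B x -> B y -> B (x ** y),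
      forall x, B x -> B (x^*)
    & closed B].

Definition cstar_generated (R : realType) (A : cstarAlgType R) (S : set A) : set A :=
  smallest (@cstar_subalgebra R A) S.

(* The countTypes are, classically, the finite or countably infinite sets. *)
Record digraph := Digraph {
  vertex : countType;
  edge : countType;
  erange : edge -> vertex;
  esource : edge -> vertex
}.

(* The projection p_v is attached to the *source* of e by s_e^* s_e; the range
   of the partial isometry s_e is represented by the projection s_e s_e^*. *)
Record CK_family (R : realType) (E : digraph) (A : cstarAlgType R)
    (p : vertex E -> A) (s : edge E -> A) : Prop := {
  CK_proj : forall v, projection (p v);
  CK_proj_orth : forall v w, v <> w -> p v ** p w = 0;
  CK_piso : forall e, partial_isometry (s e);
  CK_range_orth : forall e f, e <> f ->
    (s e ** (s e)^*) ** (s f ** (s f)^*) = 0;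
  CK_source : forall e, (s e)^* ** s e = p (esource e);
  CK_range : forall e, cle (s e ** (s e)^*) (p (erange e));
  CK_sum : forall v,
    @erange E @^-1` [set v] !=set0 ->
    finite_set (@erange E @^-1` [set v]) ->
    p v = \sum_(e \in @erange E @^-1` [set v]) (s e ** (s e)^*)
}.

(* Main.v *)
(* Let [q_e = s_e s_e^*], call a vertex dead if it is the source of no edge, and put
     [D = sum_e d_e q_e],  [X = sum_e a_e s_e + sum_(w dead) b_w p_w]
   with coefficients that decrease very rapidly.  The generator is [x = X (1 + D)].
   The projections are recovered one after the other: after the columns already
   known have been removed from [x], a suitable multiple of [x] (for a dead vertex),
   or of [x^* x] (for a vertex with no edge into a dead vertex), is close to the
   next [p_v] and leaves its range invariant, so a functional calculus near {0, 1}
   gives [p_v].  Once [p_v] is known, [(x p_v)^* (x p_v)] is a multiple of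
   [p_v (1 + D)^2], from which the [q_e] with range [v] are peeled off in the same
   way; when [v] is dead, [q_e x] then yields [s_e (1 + D)], and hence the
   projection of the source of [e].  At the end [q_e x p_v = a_e s_e (1 + D)] with
   [D] known and small. *)
Require Import Defs.
From mathcomp Require Import all_boot all_order all_algebra complex.
From mathcomp Require Import all_classical all_reals all_analysis.
From mathcomp Require Import ring lra.

Set Implicit Arguments.
Unset Strict Implicit.
Unset Printing Implicit Defensive.

Import Order.TTheory GRing.Theory Num.Theory.
Import numFieldNormedType.Exports.

Local Open Scope classical_set_scope.
Local Open Scope ring_scope.
Local Open Scope complex_scope.
Local Open Scope cstar_scope.

Local Notation "x ^*" := (cstar x) : ring_scope.

(** Why [X] alone is not enough: at a single vertex with several loops it is a scalar multiple of an
    isometry, which cannot tell the loops apart. The right factor [1 + D] gives each [q_e] its own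
    eigenvalue, and [D] still commutes with every [p_v], so columns can be cut out as before. A dead
    vertex is invisible to all [s_e^* s_e], so its projection has to enter [X] itself. The price is
    a cross term: if [e] ends in a dead [w], then [q_e X] contains [b_w q_e] besides [a_e s_e], and
    [x^* x] need not leave the range of [p_v] invariant for [v] the source of [e]. The numbering of
    the summands is chosen so that some dead target of [v] is settled before [v] is needed. Edges
    ending at a dead [w] also spoil commutation with [p_w]: only [z p = p z p] is available there.
    Hence the functional calculus is a cubic iteration inside a closed algebra that need not contain
    adjoints. No spectrum is used; positivity enters through norm estimates only. *)

(** * Linear identities in a module, by reflection *)

Inductive lexp (K : Type) : Type :=
  | LVar of nat
  | LZero
  | LAdd of lexp K & lexp K
  | LOpp of lexp K
  | LScale of K & lexp K.
Arguments LVar {K}.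
Arguments LZero {K}.

Section LinearExpressions.
Variables (K : comNzRingType) (V : lmodType K).

Fixpoint leval (env : seq V) (e : lexp K) : V :=
  match e with
  | LVar n => nth 0 env n
  | LZero => 0
  | LAdd e1 e2 => leval env e1 + leval env e2
  | LOpp e1 => - leval env e1
  | LScale c e1 => c *: leval env e1
  end.

Fixpoint lcoef (e : lexp K) (i : nat) : K :=
  match e with
  | LVar n => if eqn n i then 1 else 0
  | LZero => 0
  | LAdd e1 e2 => lcoef e1 i + lcoef e2 i
  | LOpp e1 => - lcoef e1 i
  | LScale c e1 => c * lcoef e1 i
  end.

Lemma leval_sum env e : leval env e = \sum_(i < size env) lcoef e i *: env`_i.
Proof.
elim: e => [n||e1 ih1 e2 ih2|e1 ih1|c e1 ih1].
- have lcoefV i : lcoef (LVar n) i = (n == i)%:R.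
    by rewrite /lcoef -[eqn n i]/(n == i); case: eqP.
  have [nlt|nge] := ltnP n (size env).
    rewrite (bigD1 (Ordinal nlt)) // lcoefV eqxx scale1r big1 => [|i].
      by rewrite /= addr0.
    by rewrite -val_eqE lcoefV /= eq_sym => /negPf ->; rewrite scale0r.
  rewrite /= nth_default// big1// => i _; rewrite -/(lcoef (LVar n) i).
  rewrite lcoefV; case: eqP => [ni|]; last by rewrite scale0r.
  by have := ltn_ord i; rewrite -ni ltnNge nge.
- by rewrite big1// => i _; rewrite scale0r.
- by rewrite /= ih1 ih2 -big_split; apply: eq_bigr => i _; rewrite scalerDl.
- by rewrite /= ih1 -sumrN; apply: eq_bigr => i _; rewrite scaleNr.
- by rewrite /= ih1 scaler_sumr; apply: eq_bigr => i _; rewrite scalerA.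
Qed.

Fixpoint lcoef_eq (e1 e2 : lexp K) (n : nat) : Prop :=
  match n with
  | 0 => True
  | m.+1 => lcoef e1 m = lcoef e2 m /\ lcoef_eq e1 e2 m
  end.

(** Sufficient only: linear dependencies between atoms are ignored. Products and adjoints are atoms,
    so they have to be expanded beforehand. *)
Lemma leval_eq env e1 e2 :
  lcoef_eq e1 e2 (size env) -> leval env e1 = leval env e2.
Proof.
rewrite !leval_sum; elim: (size env) => [|n ih] /=; first by rewrite !big_ord0.
by case=> en /ih; rewrite !big_ord_recr /= en => ->.
Qed.

End LinearExpressions.

Ltac lfind x env :=
  match env with
  | x :: _ => constr:(0%N)
  | _ :: ?t => let n := lfind x t in constr:(S n)
  end.
Ltac latoms t env :=
  match t with
  | @GRing.zero _ => env
  | @GRing.add _ ?a ?b => let env1 := latoms a env in latoms b env1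
  | @GRing.opp _ ?a => latoms a env
  | @GRing.scale _ _ _ ?a => latoms a env
  | _ => match constr:(tt) with
         | _ => let n := lfind t env in env
         | _ => constr:(t :: env)
         end
  end.
Ltac lreify K t env :=
  match t with
  | @GRing.zero _ => constr:(@LZero K)
  | @GRing.add _ ?a ?b =>
      let ea := lreify K a env in let eb := lreify K b env in
      constr:(@LAdd K ea eb)
  | @GRing.opp _ ?a => let ea := lreify K a env in constr:(@LOpp K ea)
  | @GRing.scale _ _ ?c ?a =>
      let ea := lreify K a env in constr:(@LScale K c ea)
  | _ => let n := lfind t env in constr:(@LVar K n)
  end.
Ltac lmod_core K tac :=
  match goal with
  | |- @eq ?T ?a ?b =>
    let env := latoms a (@nil T) in
    let env := latoms b env in
    let ea := lreify K a env in
    let eb := lreify K b env in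
    refine (@leval_eq _ _ env ea eb _);
    lazy [lcoef_eq lcoef size eqn]; repeat split; tac
  end.

(* Equalities in a module, by comparing the coefficients of every atom. *)
Ltac lmod :=
  match goal with R : realType |- _ =>
    lmod_core (complex R) ltac:(first [by [] | by ring | by field])
  end.

(** * Norm and involution in a C*-algebra *)

Section Algebra.
Variables (R : realType) (A : cstarAlgType R).
Implicit Types (a b c d : A) (r t : R).

Lemma cmul0l a : 0 ** a = 0.
Proof. by rewrite -(scale0r (0 : A)) cmulZl !scale0r. Qed.

Lemma cmul0r a : a ** 0 = 0.
Proof. by rewrite -(scale0r (0 : A)) cmulZr !scale0r. Qed.

Lemma cmulNl a b : (- a) ** b = - (a ** b).
Proof. by rewrite -scaleN1r cmulZl scaleN1r. Qed.

Lemma cmulNr a b : a ** (- b) = - (a ** b).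
Proof. by rewrite -scaleN1r cmulZr scaleN1r. Qed.

Lemma cmulBl a b c : (a - b) ** c = a ** c - b ** c.
Proof. by rewrite cmulDl cmulNl. Qed.

Lemma cmulBr a b c : a ** (b - c) = a ** b - a ** c.
Proof. by rewrite cmulDr cmulNr. Qed.

Lemma cstar0 : (0 : A)^* = 0.
Proof. by rewrite -(scale0r (0 : A)) cstarZ conjc0 !scale0r. Qed.

Lemma cstarN a : (- a)^* = - a^*.
Proof. by rewrite -scaleN1r cstarZ rmorphN rmorph1 scaleN1r. Qed.

Lemma cstarB a b : (a - b)^* = a^* - b^*.
Proof. by rewrite cstarD cstarN. Qed.

Lemma cstarZr r a : (r%:C *: a)^* = r%:C *: a^*.
Proof. by rewrite cstarZ conjc_real. Qed.

Definition cstarE :=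
  (@cstarD R A, cstarB, cstarN, cstarZr, @cstarM R A, @cstarK R A, cstar0).

Definition cmulE := (@cmulDl R A, @cmulDr R A, cmulBl, cmulBr, cmulNl, cmulNr,
  @cmulZl R A, @cmulZr R A, @cmulA R A, cmul0l, cmul0r).

(** The norm takes values in [R[i]]; its real part opens the estimates to [lra] and [nra], and
    [rnormE] shows that nothing is lost. *)
Definition rnorm a : R := complex.Re `|a|.

Lemma rnormE a : `|a| = (rnorm a)%:C.
Proof. by rewrite RRe_real// ger0_real. Qed.

Lemma rnorm_ge0 a : 0 <= rnorm a.
Proof. by rewrite -ler0c -rnormE. Qed.

Lemma rnorm0 : rnorm 0 = 0.
Proof. by rewrite /rnorm normr0. Qed.

Lemma rnorm_eq0 a : rnorm a = 0 -> a = 0.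
Proof. by move=> a0; apply/eqP; rewrite -normr_eq0 rnormE a0. Qed.

Lemma rnormN a : rnorm (- a) = rnorm a.
Proof. by rewrite /rnorm normrN. Qed.

Lemma rnormD a b : rnorm (a + b) <= rnorm a + rnorm b.
Proof. by rewrite -lecR rmorphD/= -!rnormE ler_normD. Qed.

Lemma rnormB a b : rnorm (a - b) <= rnorm a + rnorm b.
Proof. by rewrite -(rnormN b) rnormD. Qed.

Lemma rnormC a b : rnorm (a - b) = rnorm (b - a).
Proof. by rewrite -rnormN opprB. Qed.

Lemma rnormZ r a : rnorm (r%:C *: a) = `|r| * rnorm a.
Proof.
apply: complexI; rewrite -rnormE normrZ rnormE rmorphM/=; congr (_ * _).
by rewrite normc_def/= expr0n addr0 sqrtr_sqr.
Qed.

Lemma rnormM a b : rnorm (a ** b) <= rnorm a * rnorm b.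
Proof. by rewrite -lecR rmorphM/= -!rnormE cnormM. Qed.

Lemma rnorm_starM a : rnorm (a^* ** a) = rnorm a ^+ 2.
Proof. by apply: complexI; rewrite -rnormE cnorm_star rnormE rmorphXn. Qed.

Lemma rnorm_star a : rnorm a^* = rnorm a.
Proof.
have le b : rnorm b <= rnorm b^*.
  have [b0|] := eqVneq (rnorm b) 0; first by rewrite b0 rnorm_ge0.
  move=> b0; have bgt0 : 0 < rnorm b by rewrite lt_neqAle eq_sym b0 rnorm_ge0.
  by rewrite -(ler_pM2r bgt0) -expr2 -rnorm_starM rnormM.
by apply/eqP; rewrite eq_le le -{2}(cstarK a) le.
Qed.

Lemma rnorm_star_le a b : a^* ** a = b^* ** b -> rnorm a = rnorm b.
Proof.
move=> ab; apply/eqP; rewrite -(@eqrXn2 _ 2)// ?rnorm_ge0//.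
by rewrite -!rnorm_starM ab.
Qed.

Lemma starM_eq0 a : a^* ** a = 0 -> a = 0.
Proof.
move=> a0; apply: rnorm_eq0; rewrite -rnorm0; apply: rnorm_star_le.
by rewrite a0 cmul0r.
Qed.

Lemma rnormM_le a b r t : rnorm a <= r -> rnorm b <= t -> rnorm (a ** b) <= r * t.
Proof.
by move=> ar bt; rewrite (le_trans (rnormM _ _))// ler_pM// rnorm_ge0.
Qed.

Lemma rnormD_le a b r t : rnorm a <= r -> rnorm b <= t -> rnorm (a + b) <= r + t.
Proof. by move=> ar bt; rewrite (le_trans (rnormD _ _))// lerD. Qed.

Lemma rnormB_le a b r t : rnorm a <= r -> rnorm b <= t -> rnorm (a - b) <= r + t.
Proof. by move=> ar bt; rewrite (le_trans (rnormB _ _))// lerD. Qed.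

Lemma rnorm_le0 a : (forall r, 0 < r -> rnorm a <= r) -> a = 0.
Proof.
move=> ar; apply: rnorm_eq0; apply/eqP; rewrite eq_le rnorm_ge0 andbT.
by apply/ler_addgt0Pl => e e0; rewrite addr0 ar.
Qed.

(** Applied to differences that happen to be idempotent, this turns closeness into equality. *)
Lemma idempotent_small a : a ** a = a -> rnorm a < 1 -> a = 0.
Proof.
move=> aa a1; apply: rnorm_eq0; apply/eqP; rewrite eq_le rnorm_ge0 andbT.
have := rnormM a a; rewrite aa => aM; have := rnorm_ge0 a; nra.
Qed.

Lemma closed_approx (B : set A) a : closed B ->
  (forall r, 0 < r -> exists2 b, B b & rnorm (a - b) <= r) -> B a.
Proof.
move=> Bc aB; apply: Bc => U /nbhs_ballP[e /= e0 eU].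
have er : e = (complex.Re e)%:C by rewrite RRe_real// gtr0_real.
rewrite er ltcR in e0.
have [|b Bb ab] := aB (complex.Re e / 2); first by rewrite divr_gt0.
exists b; split=> //; apply: eU; rewrite -ball_normE /= rnormE er ltcR.
by apply: le_lt_trans ab _; rewrite ltr_pdivrMr// ltr_pMr// ltr1n.
Qed.

End Algebra.

(** * Geometric bounds and convergent series *)

Lemma geometric_small (R : realType) (C e r : R) : 0 <= r <= 2^-1 -> 0 < e ->
  exists n, forall m, (n <= m)%N -> C * r ^+ m <= e.
Proof.
move=> /andP[r0 r2] e0; pose n := Num.bound (`|C| / e); exists n => m nm.
have Ce : `|C| <= e * 2 ^+ m.
  rewrite -ler_pdivrMl// mulrC.
  have /ltW/le_trans := archi_boundP (divr_ge0 (normr_ge0 C) (ltW e0)); apply.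
  rewrite -natrX ler_nat; apply: leq_trans nm _.
  exact/ltnW/ltn_expl.
have rm : r ^+ m <= (2 ^+ m)^-1.
  by rewrite -exprVn lerXn2r// nnegrE// invr_ge0.
have r0m : 0 <= r ^+ m by rewrite exprn_ge0.
apply: le_trans (_ : `|C| * r ^+ m <= _).
  by rewrite ler_wpM2r// ler_norm.
apply: le_trans (_ : `|C| * (2 ^+ m)^-1 <= _); first by rewrite ler_wpM2l.
by rewrite ler_pdivrMr// exprn_gt0.
Qed.

Section Series.
Variables (R : realType) (A : cstarAlgType R).
Implicit Types (u : nat -> A) (C e r : R).

Lemma partial_sum_tail u C r : 0 <= r <= 2^-1 ->
  (forall k, rnorm (u k) <= C * r ^+ k) ->
  forall j n, rnorm (\sum_(n <= k < n + j) u k) <= 2 * C * r ^+ n.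
Proof.
move=> /andP[r0 r2] uC; have C0 : 0 <= C.
  by have := uC 0; rewrite expr0 mulr1; apply: le_trans (rnorm_ge0 _).
elim=> [|j ih] n.
  by rewrite addn0 big_geq// rnorm0 !mulr_ge0// exprn_ge0.
rewrite addnS big_ltn ?ltnS ?leq_addr// -addSn.
apply: le_trans (rnormD_le (uC n) (ih n.+1)) _; rewrite exprS.
have : 0 <= r ^+ n by rewrite exprn_ge0.
have Cr : C * r <= C * 2^-1 by rewrite ler_wpM2l.
by nra.
Qed.

Lemma series_exists u C r : 0 <= r <= 2^-1 ->
  (forall k, rnorm (u k) <= C * r ^+ k) ->
  exists S, forall n, rnorm (S - \sum_(0 <= k < n) u k) <= 2 * C * r ^+ n.
Proof.
move=> r01 uC; pose v n := \sum_(0 <= k < n) u k.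
have vD n m : (n <= m)%N -> rnorm (v m - v n) <= 2 * C * r ^+ n.
  move=> nm; rewrite /v (big_cat_nat _ nm)//= addrAC subrr add0r -(subnKC nm).
  exact: partial_sum_tail.
have : cvg (v @ \oo).
  apply/cauchy_cvgP/cauchy_exP => e e0.
  have er : e = (complex.Re e)%:C by rewrite RRe_real// gtr0_real.
  rewrite er ltcR in e0.
  have [|n Cn] := @geometric_small R (2 * C) (complex.Re e / 2) _ r01.
    by rewrite divr_gt0.
  exists (v n); exists n => // m /= nm.
  rewrite -ball_normE /= rnormE er ltcR rnormC.
  apply: le_lt_trans (le_trans (vD _ _ nm) (Cn _ (leqnn _))) _.
  by rewrite ltr_pdivrMr// ltr_pMr// ltr1n.
move=> /cvg_ex[S vS]; exists S => n.
apply/ler_addgt0Pl => e e0.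
move/cvgrPdist_lt: vS => /(_ (e%:C)); rewrite ltcR => /(_ e0)[N _ vN].
have := vN (maxn N n) (leq_maxl _ _); rewrite rnormE ltcR => SN.
have -> : S - v n = (S - v (maxn N n)) + (v (maxn N n) - v n) by lmod.
apply: rnormD_le; first exact: ltW.
by rewrite vD// leq_maxr.
Qed.

End Series.

(** * Positive elements *)

Section Kaplansky.
Variables (R : realType) (A : cstarAlgType R).
Implicit Types (a b c d x y z : A) (r s t : R).

(** Self-adjoint operators on [A] seen as a Hilbert module over itself, with inner product [a^* b].
    They stand for elements such as [1 - y^2] of the unitization. *)
Definition selfadjoint_op (T : A -> A) :=
  forall a b, (T a)^* ** b = a^* ** T b.

(** For commuting [T] and [S] the mixed terms of [T + iS] and of [T - iS] cancel, and [T^2 + S^2]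
    remains. *)
Lemma selfadjoint_op_normal (T S : A -> A) d :
  selfadjoint_op T -> selfadjoint_op S -> T (S d) = S (T d) ->
  (T d + 'i *: S d)^* ** (T d + 'i *: S d) = d^* ** (T (T d) + S (S d)) /\
  (T d - 'i *: S d)^* ** (T d - 'i *: S d) = d^* ** (T (T d) + S (S d)).
Proof.
move=> Ts Ss TS.
have ii : 'i * 'i = -1 :> R[i] by rewrite -expr2 sqr_i.
have conji : conjc 'i = - 'i :> R[i].
  by apply/eqP; rewrite eq_complex /= ?oppr0 !eqxx.
rewrite !cstarE !cstarZ conji !cmulE !Ts !Ss TS !scalerA.
by split; lmod_core R[i] ltac:(ring: ii).
Qed.

(** The two perturbed vectors have equal norm by the C*-identity, and [T d] is their midpoint. *)
Lemma selfadjoint_op_norm (T S : A -> A) d :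
  selfadjoint_op T -> selfadjoint_op S -> T (S d) = S (T d) ->
  rnorm (T d) <= rnorm (T d + 'i *: S d) /\
  rnorm (T d) <= rnorm (T d - 'i *: S d).
Proof.
move=> Ts Ss /(selfadjoint_op_normal Ts Ss)[ep em].
have pm : rnorm (T d + 'i *: S d) = rnorm (T d - 'i *: S d).
  by apply: rnorm_star_le; rewrite ep em.
have : rnorm ((2^-1)%:C *: ((T d + 'i *: S d) + (T d - 'i *: S d))) <=
    2^-1 * (rnorm (T d + 'i *: S d) + rnorm (T d - 'i *: S d)).
  by rewrite rnormZ ger0_norm// ler_wpM2l// rnormD.
have -> : (2^-1)%:C *: ((T d + 'i *: S d) + (T d - 'i *: S d)) = T d.
  by lmod.
rewrite pm; split; lra.
Qed.

Lemma lmul_selfadjoint x : x^* = x -> selfadjoint_op (fun a => x ** a).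
Proof. by move=> xx a b; rewrite cstarM xx cmulA. Qed.

(** Here [1 + x^2 = (1 - ix)(1 + ix)], and neither factor decreases norms, by [selfadjoint_op_norm]
    with [T = id]. *)
Lemma sqr_le_1sqr x d : x^* = x -> rnorm d <= rnorm (d + x ** (x ** d)).
Proof.
move=> xs; have ids : selfadjoint_op (id : A -> A) by [].
have xo := lmul_selfadjoint xs.
have [le1 _] := @selfadjoint_op_norm id (fun a => x ** a) d ids xo erefl.
apply: le_trans le1 _; set w := id d + _.
have [_ le2] := @selfadjoint_op_norm id (fun a => x ** a) w ids xo erefl.
apply: le_trans le2 _; rewrite (_ : _ - _ = d + x ** (x ** d))// /w /=.
have ii : 'i * 'i = -1 :> R[i] by rewrite -expr2 sqr_i.
by rewrite !cmulE; lmod_core R[i] ltac:(ring: ii).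
Qed.

(* [1 + y^4 = (1 - y^2)^2 + 2 y^2], a sum of two commuting squares *)
Lemma two_sqr_le y d : y^* = y ->
  2 * rnorm (y ** (y ** d)) <= rnorm (d + y ** (y ** (y ** (y ** d)))).
Proof.
move=> ys; have yo := lmul_selfadjoint ys.
pose T a := (Num.sqrt 2 : R)%:C *: (y ** a).
pose S a := a - y ** (y ** a).
have To : selfadjoint_op T.
  by move=> a b; rewrite /T !cstarE ys !cmulE.
have So : selfadjoint_op S.
  by move=> a b; rewrite /S !cstarE ys !cmulE.
have TS a : T (S a) = S (T a) by rewrite /T /S !cmulE scalerBr.
have ss : (Num.sqrt 2 : R)%:C * (Num.sqrt 2 : R)%:C = 2 :> R[i].
  by rewrite -rmorphM/= -expr2 sqr_sqrtr// rmorph_nat.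
have TTE : T (T d) = (2 : R)%:C *: (y ** (y ** d)).
  by rewrite /T !cmulE scalerA ss rmorph_nat.
have -> : 2 * rnorm (y ** (y ** d)) = rnorm (T (T d)).
  by rewrite TTE rnormZ ger0_norm.
have [_ le1] := selfadjoint_op_norm To So (TS (T d)).
apply: le_trans le1 _; set w := T d - 'i *: S d.
have -> : T (T d) - 'i *: S (T d) = T w.
  rewrite -TS /w /T !cmulE.
  by rewrite [X in X - _]scalerA; lmod.
have [le2 _] := selfadjoint_op_norm To So (TS w).
apply: le_trans le2 _; rewrite (_ : _ + _ = d + y ** (y ** (y ** (y ** d))))//.
have ii : 'i * 'i = -1 :> R[i] by rewrite -expr2 sqr_i.
by rewrite /w /T /S !cmulE; lmod_core R[i] ltac:(ring: ii ss).
Qed.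

(** Comes from [(1 - s x^2)^2 + 2 s x^2 = 1 + s^2 x^4]. What matters is that the excess over 1 is of
    second order in [s]. *)
Lemma sub_sqr_norm x d s : x^* = x -> 0 <= s ->
  rnorm (d - s%:C *: (x ** (x ** d))) <= (1 + s ^+ 2 * rnorm x ^+ 4) * rnorm d.
Proof.
move=> xs s0; have xo := lmul_selfadjoint xs.
pose T a := a - s%:C *: (x ** (x ** a)).
pose S a := (Num.sqrt (2 * s) : R)%:C *: (x ** a).
have To : selfadjoint_op T.
  by move=> a b; rewrite /T !cstarE xs !cmulE.
have So : selfadjoint_op S.
  by move=> a b; rewrite /S !cstarE xs !cmulE.
have TS a : T (S a) = S (T a).
  by rewrite /T /S !cmulE scalerBr; lmod.
have ss : (Num.sqrt (2 * s) : R)%:C * (Num.sqrt (2 * s) : R)%:C = 2 * s%:C :> R[i].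
  by rewrite -rmorphM/= -expr2 sqr_sqrtr ?mulr_ge0// rmorphM rmorph_nat.
have [le1 _] := selfadjoint_op_norm To So (TS d).
apply: le_trans le1 _; set w := T d + _.
have [wE _] := selfadjoint_op_normal To So (TS d).
have w2 : rnorm w ^+ 2 <= rnorm d * ((1 + s ^+ 2 * rnorm x ^+ 4) * rnorm d).
  rewrite -rnorm_starM wE; apply: rnormM_le; first by rewrite rnorm_star.
  have -> : T (T d) + S (S d) =
      d + (s ^+ 2)%:C *: (x ** (x ** (x ** (x ** d)))).
    by rewrite /T /S !cmulE; lmod_core R[i] ltac:(ring: ss).
  rewrite mulrDl mul1r; apply: rnormD_le => //.
  rewrite rnormZ ger0_norm ?sqr_ge0// -mulrA ler_wpM2l ?sqr_ge0//.
  by rewrite !exprS expr0 mulr1 -!mulrA; do 4 (apply: rnormM_le => //).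
have d0 := rnorm_ge0 d; have w0 := rnorm_ge0 w.
have k0 : 0 <= s ^+ 2 * rnorm x ^+ 4 by rewrite mulr_ge0 ?exprn_ge0// rnorm_ge0.
rewrite -(@ler_pXn2r _ 2)// ?nnegrE//; last by rewrite mulr_ge0// addr_ge0.
apply: le_trans w2 _; set k := s ^+ 2 * _ in k0 *; nra.
Qed.

(** The squares need not commute, so the sum is not factored: the bounds for [1 - 3 s x^2],
    [1 - 3 s y^2] and [1 - 3 s z^2] are averaged, and [s] tends to 0. *)
Lemma sum_sqr_accretive x y z t d : x^* = x -> y^* = y -> z^* = z -> 0 <= t ->
  rnorm d <= rnorm (d + t%:C *: (x ** (x ** d) + y ** (y ** d) + z ** (z ** d))).
Proof.
move=> xs ys zs; rewrite le_eqVlt => /predU1P[<-|t0].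
  by rewrite scale0r addr0.
set h := _ + z ** (z ** d); set w := d + _.
pose K := rnorm x ^+ 4 + rnorm y ^+ 4 + rnorm z ^+ 4.
have [x4 y4 z4] : [/\ 0 <= rnorm x ^+ 4, 0 <= rnorm y ^+ 4 & 0 <= rnorm z ^+ 4].
  by rewrite !exprn_ge0// rnorm_ge0.
have d0 := rnorm_ge0 d; have w0 := rnorm_ge0 w.
have bound s : 0 < s -> rnorm d <= rnorm w + s * (9 * K * t * rnorm d).
  move=> s0.
  have sq v : v^* = v -> rnorm v ^+ 4 <= K ->
      rnorm (d - (3 * s)%:C *: (v ** (v ** d))) <= (1 + 9 * s ^+ 2 * K) * rnorm d.
    move=> vs vK; apply: le_trans (sub_sqr_norm _ vs _) _; first nra.
    rewrite ler_wpM2r// lerD2l exprMn; have := sqr_ge0 s; nra.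
  have hs : rnorm (d - s%:C *: h) <= (1 + 9 * s ^+ 2 * K) * rnorm d.
    have -> : d - s%:C *: h = (3^-1)%:C *: ((d - (3 * s)%:C *: (x ** (x ** d))) +
        (d - (3 * s)%:C *: (y ** (y ** d))) + (d - (3 * s)%:C *: (z ** (z ** d)))).
      by rewrite /h; lmod.
    rewrite rnormZ ger0_norm//.
    have [xK yK zK] : [/\ rnorm x ^+ 4 <= K, rnorm y ^+ 4 <= K & rnorm z ^+ 4 <= K].
      by rewrite /K; split; lra.
    have := rnormD_le (rnormD_le (sq x xs xK) (sq y ys yK)) (sq z zs zK).
    by rewrite ler_pdivrMl// => /le_trans; apply; lra.
  (* The first summand exceeds the norm of [d] by order [s^2] only, so dividing by [s / t] leaves an
     error of order [s]. *)
  have dE : (1 + s / t)%:C *: d = (d - s%:C *: h) + (s / t)%:C *: w.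
    have tN : t%:C != 0 :> R[i].
      by rewrite -(rmorph0 (real_complex R)) (inj_eq (@complexI R)) gt_eqF.
    rewrite /w; lmod_core R[i] ltac:(rewrite ?rmorphM ?rmorphD ?fmorphV /=; field; done).
  have st : 0 < s / t by rewrite divr_gt0.
  have : (1 + s / t) * rnorm d <= (1 + 9 * s ^+ 2 * K) * rnorm d + (s / t) * rnorm w.
    have {1}-> : (1 + s / t) * rnorm d = rnorm ((1 + s / t)%:C *: d).
      by rewrite rnormZ ger0_norm// addr_ge0// ltW.
    rewrite dE; apply: rnormD_le => //.
    by rewrite rnormZ ger0_norm// ltW.
  have sE : s ^+ 2 = (s / t) * (s * t) by field; rewrite gt_eqF.
  by rewrite sE => le; rewrite -(ler_pM2l st); lra.
apply/ler_addgt0Pl => e e0; rewrite addrC.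
have X0 : 0 <= 9 * K * t * rnorm d 
  by rewrite !mulr_ge0// ?(ltW t0)// /K; lra.
move: X0 bound; move: (9 * K * t * rnorm d) => X X0 bound.
have X1 : 0 < X + 1 by lra.
apply: le_trans (bound (e / (X + 1)) _) _; first by rewrite divr_gt0.
by rewrite lerD2l mulrAC ler_pdivrMr// ler_pM2l//; lra.
Qed.

Lemma pow_norm1 y : y^* = y -> rnorm y = 1 ->
  rnorm (y ** (y ** (y ** (y ** (y ** (y ** (y ** y))))))) = 1.
Proof.
move=> ys y1.
have sq (z : A) : z^* = z -> rnorm z = 1 -> (z ** z)^* = z ** z /\ rnorm (z ** z) = 1.
  move=> zs z1; rewrite cstarM zs; split=> //.
  by have := rnorm_starM z; rewrite zs z1 expr1n.
have [ys2 y2] := sq _ ys y1; have [ys4 y4] := sq _ ys2 y2.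
by have [_ <-] := sq _ ys4 y4; rewrite !cmulA.
Qed.

(** The product [(1 - y^2)(1 + y^2)(1 + y^4)(1 + y^8)] telescopes to [1 - y^16]. For
    [d = (1 + y^4)(1 + y^8) y^2], two uses of [two_sqr_le] give norm at least 4. Applying [1 - y^2]
    (by hypothesis) and then [1 + y^2] (by [sqr_le_1sqr]) does not decrease it, yet the result
    [y^2 - y^18] has norm at most 2. *)
Lemma sqr_expansive_contra y : y^* = y -> rnorm y = 1 ->
  (forall c, rnorm (y ** c) <= rnorm (y ** c - y ** (y ** (y ** c)))) -> False.
Proof.
move=> ys y1 yc; have yo := lmul_selfadjoint ys.
have y2s : (y ** y)^* = y ** y by rewrite cstarM ys.
pose e := y ** y + y ** (y ** (y ** (y ** (y ** (y ** (y ** (y ** (y ** y)))))))).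
pose d := e + y ** (y ** (y ** (y ** e))).
have d4 : 4 <= rnorm d.
  have := two_sqr_le e ys; rewrite -/d.
  have := two_sqr_le (y ** (y ** (y ** y))) y2s.
  have := pow_norm1 ys y1; rewrite /e !cmulE => ->; lra.
have dE : exists c, d = y ** c.
  exists (y + y ** (y ** (y ** (y ** (y ** (y ** (y ** (y ** y))))))) +
    y ** (y ** (y ** e))).
  by rewrite /d {1}/e !cmulE.
have [c dc] := dE.
have := yc c; rewrite -dc => le1.
have := sqr_le_1sqr (d - y ** (y ** d)) ys.
have -> : d - y ** (y ** d) + y ** (y ** (d - y ** (y ** d))) =
  y ** y - (y ** (y ** (y ** (y ** (y ** (y ** (y ** y)))))))
    ** (y ** (y ** (y ** (y ** (y ** (y ** (y ** y))))))) ** (y ** y).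
  by rewrite /d /e !cmulE; lmod.
have nle z z' : rnorm z <= 1 -> rnorm z' <= 1 -> rnorm (z ** z') <= 1.
  by move=> z1 z2; rewrite -(mulr1 1) rnormM_le.
have y8 : rnorm (y ** (y ** (y ** (y ** (y ** (y ** (y ** y))))))) <= 1.
  by rewrite pow_norm1.
have yy1 : rnorm (y ** y) <= 1 by rewrite nle ?y1.
have := rnormB_le yy1 (nle _ _ (nle _ _ y8 y8) yy1); lra.
Qed.

(* With [m = b b^*] and [g = a b^* = x - i y] ([x], [y] self-adjoint) one has
   [g^* g = - m^2] and [g g^* = 2 x^2 + 2 y^2 + m^2].  Accretivity of the latter
   gives [|m c| <= |m c - t m^3 c|] for all [t >= 0], which forces [m = 0].
   This is needed only to read [cle] between projections as inclusion. *)
Lemma starM_add_eq0 a b : a^* ** a + b^* ** b = 0 -> a = 0.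
Proof.
move=> ab0; have abE : a^* ** a = - (b^* ** b).
  by apply/eqP; rewrite -addr_eq0 ab0.
have [m mE] : exists m, m = b ** b^* by exists (b ** b^*).
have [g gE] : exists g, g = a ** b^* by exists (a ** b^*).
have ms : m^* = m by rewrite mE !cstarE.
have gg : g^* ** g = - (m ** m).
  by rewrite gE mE !cstarE -!cmulA (cmulA a^*) abE !cmulE.
pose x := (2^-1)%:C *: (g + g^*); pose y := (2^-1)%:C *: ('i *: (g - g^*)).
have conji : conjc 'i = - 'i :> R[i].
  by apply/eqP; rewrite eq_complex /= ?oppr0 !eqxx.
have xs : x^* = x by rewrite /x !cstarE addrC.
have ys : y^* = y.
  by rewrite /y cstarZr cstarZ conji cstarB cstarK; lmod.
have ii : 'i * 'i = -1 :> R[i] by rewrite -expr2 sqr_i.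
(* The factor [k] makes one half of [g g^*] a sum of three squares, the form that
   [sum_sqr_accretive] takes. *)
have [k kk] : exists k : R, k * k = 2^-1.
  by exists (Num.sqrt 2)^-1; rewrite -expr2 exprVn sqr_sqrtr.
have gge d : (2^-1)%:C *: (g ** (g^* ** d)) = x ** (x ** d) + y ** (y ** d) +
    (k%:C *: m) ** ((k%:C *: m) ** d).
  have ss : k%:C * k%:C = (2^-1)%:C :> R[i] by rewrite -rmorphM/= kk.
  have mm : m ** m ** d = - (g^* ** g ** d) by rewrite gg cmulNl opprK.
  rewrite /x /y !cmulE mm.
  by lmod_core R[i] ltac:(first
    [field: ii ss; done | rewrite ?mulrN1 ?mulrA ?mulrN ss; field: ii; done]).
have kms : (k%:C *: m)^* = k%:C *: m by rewrite cstarZr ms.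
have gm u : rnorm (g ** u) = rnorm (m ** u).
  apply/eqP; rewrite -(@eqrXn2 _ 2)// ?rnorm_ge0// -!rnorm_starM !cstarM ms.
  by rewrite -!cmulA (cmulA g^*) gg (cmulA m) !cmulE rnormN.
(* Accretivity is applied to the vector [g c]: since [g g^* g = - g m^2], every term has [g] on the
   left, where [gm] trades it for [m]. *)
have mle t c : 0 <= t ->
    rnorm (m ** c) <= rnorm (m ** c - t%:C *: (m ** (m ** (m ** c)))).
  move=> t0; have t20 : 0 <= 2 * t by rewrite mulr_ge0.
  have := sum_sqr_accretive (g ** c) xs ys kms t20.
  rewrite -gge; have -> : g ** c + (2 * t)%:C *: ((2^-1)%:C *: (g ** (g^* ** (g ** c))))
      = g ** (c - t%:C *: (m ** (m ** c))).
    rewrite (cmulA g^* g c) gg !cmulE.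
    by lmod_core R[i] ltac:(rewrite ?rmorphM; field; done).
  by rewrite !gm !cmulE.
have m0 : rnorm m = 0.
  apply/eqP/negPn/negP => mN0.
  have mgt0 : 0 < rnorm m by rewrite lt_neqAle eq_sym mN0 rnorm_ge0.
  pose y' := (rnorm m)^-1%:C *: m.
  apply: (@sqr_expansive_contra y').
  - by rewrite /y' cstarZr ms.
  - by rewrite /y' rnormZ ger0_norm ?invr_ge0 ?ltW// mulVf.
  - move=> c; rewrite /y'; set r := (rnorm m)^-1.
    have r0 : 0 <= r by rewrite invr_ge0 ltW.
    have := mle (r ^+ 2) (r%:C *: c) (sqr_ge0 _).
    rewrite [X in rnorm X <= _ -> _](_ : _ = (r%:C *: m) ** c); last by rewrite !cmulE.
    move=> /le_trans; apply; rewrite le_eqVlt; apply/orP; left; apply/eqP; congr rnorm.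
    by rewrite !cmulE; lmod.
have b0 : b^* = 0.
  by apply: starM_eq0; rewrite cstarK -mE; apply: rnorm_eq0.
by apply: starM_eq0; rewrite abE b0 cmul0l oppr0.
Qed.

End Kaplansky.

(** * Projections in a closed subalgebra *)

Section Idempotents.
Variables (R : realType) (A : cstarAlgType R).
Implicit Types (a b c d e f p z : A) (B : set A) (r s t : R).

(** Adjoints are left out on purpose: the elements leaving the range of [p] invariant, as in
    [invariant_subalgebra], usually do not form a self-adjoint set. *)
Definition closed_subalgebra B :=
  [/\ B 0, (forall x y, B x -> B y -> B (x + y)),
      (forall (k : R[i]) x, B x -> B (k *: x)),
      (forall x y, B x -> B y -> B (x ** y))
    & (forall a, (forall r, 0 < r -> exists2 b, B b & rnorm (a - b) <= r) -> B a)].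

Lemma closed_subalgebraB B x y : closed_subalgebra B -> B x -> B y -> B (x - y).
Proof.
by move=> [_ BD BZ _ _] Bx By; rewrite -(scaleN1r y); apply/BD/BZ.
Qed.

(* [t |-> 3 t^2 - 2 t^3] fixes 0 and 1 and is stationary there, so its iterates
   turn an almost idempotent element into an idempotent. *)
Definition newton e := 3%:C *: (e ** e) - 2%:C *: (e ** e ** e).

Lemma newton_sub e :
  newton e - e = (e ** e - e) - 2%:C *: (e ** (e ** e - e)).
Proof. by rewrite /newton !cmulE; lmod. Qed.

Lemma newton_defect e (q := e ** e - e) :
  newton e ** newton e - newton e = 4%:C *: (q ** q ** q) - 3%:C *: (q ** q).
Proof. by rewrite /q /newton !cmulE; lmod. Qed.

Lemma newton_idempotent B p e t : closed_subalgebra B -> p ** p = p ->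
  rnorm p <= 1 -> B e -> rnorm (e - p) <= t -> t <= 50^-1 ->
  exists2 f, B f & f ** f = f /\ rnorm (f - p) <= 41 * t.
Proof.
move=> BB pp p1 Be ep t50; have [B0 BD BZ BM Bcl] := BB.
have t0 : 0 <= t := le_trans (rnorm_ge0 _) ep.
pose u k := iter k newton e.
pose q k := u k ** u k - u k.
have h01 : 0 <= (2^-1 : R) <= 2^-1 by rewrite lexx invr_ge0 ler0n.
have Bu k : B (u k).
  elim: k => [//|k ih]; rewrite /u iterS -/(u k) /newton.
  by apply: closed_subalgebraB => //; apply: BZ; apply: (BM) => //; exact: BM.
have norm2 f : rnorm (f - p) <= 1 -> rnorm f <= 2.
  by move=> fp; rewrite -(subrK p f) (le_trans (rnormD_le fp p1))//; lra.
have step k : rnorm (q k) <= 4 * t * 2^-1 ^+ k /\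
    rnorm (u k - p) <= t + 40 * t * (1 - 2^-1 ^+ k).
  elim: k => [|k [qk uk]].
    rewrite expr0 /q /u /=; split; last by lra.
    have -> : e ** e - e = (e - p) ** (e - p) + p ** (e - p) + (e - p) ** p - (e - p).
      by rewrite !cmulE pp; lmod.
    have := rnormB_le (rnormD_le (rnormD_le (rnormM_le ep ep) (rnormM_le p1 ep))
      (rnormM_le ep p1)) ep.
    by move/le_trans; apply; nra.
  have x0 : 0 <= (2^-1 : R) ^+ k by rewrite exprn_ge0// invr_ge0.
  have x1 : (2^-1 : R) ^+ k <= 1 by rewrite exprn_ile1 ?invr_ge0// invf_le1// ler1n.
  move: qk uk x0 x1; rewrite exprS; set x := 2^-1 ^+ k => qk uk x0 x1.
  have u2 : rnorm (u k) <= 2 by apply: norm2; apply: le_trans uk _; nra.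
  have q0 := rnorm_ge0 (q k).
  have ukS : u k.+1 = newton (u k) by [].
  split.
    rewrite /q ukS newton_defect -/(q k).
    apply: le_trans (rnormB_le (_ : _ <= 4 * (rnorm (q k)) ^+ 3)
      (_ : _ <= 3 * (rnorm (q k)) ^+ 2)) _.
    - rewrite rnormZ ger0_norm// ler_wpM2l// !exprSr expr0 mul1r.
      by do 2 apply: rnormM_le => //.
    - by rewrite rnormZ ger0_norm// ler_wpM2l// expr2 rnormM.
    have : rnorm (q k) <= 2 / 25 by nra.
    move: (rnorm (q k)) q0 qk => y y0 yx y8.
    have : y ^+ 2 <= 2 / 25 * y by nra.
    have : y ^+ 3 <= 2 / 25 * (2 / 25 * y) by nra.
    nra.
  have -> : u k.+1 - p = (u k - p) + (newton (u k) - u k) by rewrite ukS; lmod.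
  rewrite newton_sub -/(q k).
  apply: le_trans (rnormD_le uk (rnormB_le qk (_ : _ <= 2 * (2 * (4 * t * x))))) _.
    by rewrite rnormZ ger0_norm// ler_wpM2l// rnormM_le.
  by lra.
have incr k : rnorm (u k.+1 - u k) <= 20 * t * 2^-1 ^+ k.
  have [qk uk] := step k.
  have x0 : 0 <= (2^-1 : R) ^+ k by rewrite exprn_ge0// invr_ge0.
  have x1 : (2^-1 : R) ^+ k <= 1 by rewrite exprn_ile1 ?invr_ge0// invf_le1// ler1n.
  have u2 : rnorm (u k) <= 2 by apply: norm2; apply: le_trans uk _; nra.
  rewrite newton_sub -/(q k).
  apply: le_trans (rnormB_le qk (_ : _ <= 2 * (2 * (4 * t * 2^-1 ^+ k)))) _.
    by rewrite rnormZ ger0_norm// ler_wpM2l// rnormM_le.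
  by lra.
have [S uS] := series_exists h01 incr.
have {}uS n : rnorm (e + S - u n) <= 40 * t * 2^-1 ^+ n.
  have := uS n; rewrite telescope_sumr//.
  rewrite (_ : S - _ = e + S - u n); last by rewrite /u /=; lmod.
  by move/le_trans; apply; lra.
have fp : rnorm (e + S - p) <= 41 * t.
  have -> : e + S - p = (e + S - u 0%N) + (e - p) by rewrite /u /=; lmod.
  have := rnormD_le (uS 0%N) ep; rewrite expr0; lra.
have f2 : rnorm (e + S) <= 2 by apply: norm2; apply: le_trans fp _; lra.
exists (e + S); last split => //.
  apply: Bcl => r r0; have [n nr] := geometric_small (40 * t) h01 r0.
  by exists (u n) => //; apply: le_trans (uS n) (nr n _).
apply/eqP; rewrite -subr_eq0; apply/eqP; apply: rnorm_le0 => r r0.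
have [n nr] := geometric_small (204 * t) h01 r0.
have [qn un] := step n.
have x0 : 0 <= (2^-1 : R) ^+ n by rewrite exprn_ge0// invr_ge0.
have x1 : (2^-1 : R) ^+ n <= 1 by rewrite exprn_ile1 ?invr_ge0// invf_le1// ler1n.
have u2 : rnorm (u n) <= 2 by apply: norm2; apply: le_trans un _; nra.
have -> : (e + S) ** (e + S) - (e + S) =
  (e + S - u n) ** (e + S) + u n ** (e + S - u n) + q n - (e + S - u n).
  by rewrite /q !cmulE; lmod.
have := rnormB_le (rnormD_le (rnormD_le (rnormM_le (uS n) f2)
  (rnormM_le u2 (uS n))) qn) (uS n).
by move/le_trans; apply; apply: le_trans (nr n (leqnn _)); lra.
Qed.

Lemma closed_subalgebraI B B' : closed_subalgebra B -> closed_subalgebra B' ->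
  closed_subalgebra (B `&` B').
Proof.
move=> [B0 BD BZ BM Bcl] [B'0 B'D B'Z B'M B'cl]; split => //.
- by move=> x y [? ?] [? ?]; split; [apply: BD|apply: B'D].
- by move=> k x [? ?]; split; [apply: BZ|apply: B'Z].
- by move=> x y [? ?] [? ?]; split; [apply: BM|apply: B'M].
- move=> a ar; split.
    by apply: Bcl => r r0; have [b [Bb _] ab] := ar r r0; exists b.
  by apply: B'cl => r r0; have [b [_ Bb] ab] := ar r r0; exists b.
Qed.

Lemma bounded_eq_closed (F : A -> A) C a :
  (forall x y, F (x - y) = F x - F y) -> (forall x, rnorm (F x) <= C * rnorm x) ->
  (forall r, 0 < r -> exists2 b, F b = 0 & rnorm (a - b) <= r) -> F a = 0.
Proof.
move=> FB FC ar; apply: rnorm_le0 => r r0.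
have C1 : 0 < `|C| + 1 by rewrite ltr_wpDl.
have [|b Fb ab] := ar (r / (`|C| + 1)); first by rewrite divr_gt0.
rewrite -[F a]subr0 -Fb -FB; apply: le_trans (FC _) _.
apply: le_trans (_ : (`|C| + 1) * rnorm (a - b) <= _).
  by rewrite ler_wpM2r ?rnorm_ge0//; have := ler_norm C; lra.
by rewrite -ler_pdivlMl// mulrC.
Qed.

Lemma invariant_subalgebra p : p ** p = p -> rnorm p <= 1 ->
  closed_subalgebra [set a | a ** p = p ** a ** p].
Proof.
move=> pp p1; split => /=.
- by rewrite !cmulE.
- by move=> x y xp yp; rewrite !cmulE xp yp.
- by move=> k x xp; rewrite !cmulE xp.
- move=> x y xp yp; by rewrite -cmulA yp !cmulE xp -[RHS]cmulA yp !cmulA.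
- move=> a ar; apply/eqP; rewrite -subr_eq0; apply/eqP.
  apply: (@bounded_eq_closed (fun a => a ** p - p ** a ** p) 2).
  + by move=> x y; rewrite !cmulE; lmod.
  + move=> x; apply: le_trans (rnormB_le (rnormM_le (lexx _) p1)
      (rnormM_le (rnormM_le p1 (lexx _)) p1)) _.
    lra.
  + by move=> r r0; have [b bp ab] := ar r r0; exists b => //; rewrite bp subrr.
Qed.

Lemma corner_subalgebra p : p ** p = p -> rnorm p <= 1 ->
  closed_subalgebra [set a | p ** a = a /\ a ** p = a].
Proof.
move=> pp p1; split => /=.
- by rewrite !cmulE.
- by move=> x y [px xp] [py yp]; rewrite !cmulE px xp py yp.
- by move=> k x [px xp]; rewrite !cmulE px xp.
- by move=> x y [px xp] [py yp]; rewrite cmulA px -cmulA yp.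
- move=> a ar; split; apply/eqP; rewrite -subr_eq0; apply/eqP.
  + apply: (@bounded_eq_closed (fun a => p ** a - a) 2).
    * by move=> x y; rewrite !cmulE; lmod.
    * move=> x; apply: le_trans (rnormB_le (rnormM_le p1 (lexx _)) (lexx _)) _; lra.
    * by move=> r r0; have [b [pb bp] ab] := ar r r0; exists b => //; rewrite pb subrr.
  + apply: (@bounded_eq_closed (fun a => a ** p - a) 2).
    * by move=> x y; rewrite !cmulE; lmod.
    * move=> x; apply: le_trans (rnormB_le (rnormM_le (lexx _) p1) (lexx _)) _; lra.
    * by move=> r r0; have [b [pb bp] ab] := ar r r0; exists b => //; rewrite bp subrr.
Qed.

Lemma projection_norm p : projection p -> rnorm p <= 1.
Proof.
move=> [pp ps]; have := rnorm_starM p; rewrite ps pp => pE.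
by have := rnorm_ge0 p; nra.
Qed.

(* An idempotent [f] obtained from [z] by functional calculus near the
   spectrum {0, 1} leaves the range of [p] invariant and is close to [p], so
   its range is the range of [p]; then [f f^*] is close to [p] in the corner. *)
Lemma projection_mem B p z : closed_subalgebra B -> (forall x, B x -> B x^*) ->
  projection p -> B z -> z ** p = p ** z ** p -> rnorm (z - p) <= 10000^-1 ->
  B p.
Proof.
move=> BB Bs pP Bz zp zp1; have p1 := projection_norm pP; case: (pP) => pp ps.
have zI : ([set a | a ** p = p ** a ** p] `&` B) z by [].
have CI := closed_subalgebraI (invariant_subalgebra pp p1) BB.
have [|f [/= fp Bf] [ff fp1]] := newton_idempotent CI pp p1 zI zp1; first by lra.
have {}fp1 : rnorm (f - p) <= 1 / 200 by lra.
have pf : p ** f = f.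
  suff : f - p ** f = 0 by move/eqP; rewrite subr_eq0 => /eqP.
  apply: idempotent_small.
    have fpf : f ** p ** f = p ** f ** p ** f by rewrite fp.
    have ffr x : x ** f ** f = x ** f by rewrite -cmulA ff.
    by rewrite !cmulE fpf ff ffr; lmod.
  have -> : f - p ** f = (f - p) - p ** (f - p) by rewrite !cmulE pp; lmod.
  by apply: le_lt_trans (rnormB_le fp1 (rnormM_le p1 fp1)) _; lra.
have fpp : f ** p = p.
  suff : p - f ** p = 0 by move/eqP; rewrite subr_eq0 => /eqP.
  apply: idempotent_small.
    have ppr x : x ** p ** p = x ** p by rewrite -cmulA pp.
    have ffp : f ** p ** f ** p = f ** p.
      by rewrite -!cmulA (cmulA p) -fp cmulA ff.
    by rewrite !cmulE pp ffp -fp ppr; lmod.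
  have -> : p - f ** p = - ((f - p) ** p) by rewrite !cmulE pp; lmod.
  by rewrite rnormN; apply: le_lt_trans (rnormM_le fp1 p1) _; lra.
have fsp : f^* ** p = f^* by rewrite -{1}ps -cstarM pf.
have hI : ([set a | p ** a = a /\ a ** p = a] `&` B) (f ** f^*).
  split; first by rewrite /= cmulA pf -cmulA fsp.
  by case: BB => _ _ _ BM _; apply/BM/Bs.
have CB := closed_subalgebraI (corner_subalgebra pp p1) BB.
have ffp1 : rnorm (f ** f^* - p) <= 1 / 90.
  have -> : f ** f^* - p = (f - p) ** (f - p)^* + (f - p) ** p + p ** (f - p)^*.
    by rewrite cstarB ps !cmulE pp; lmod.
  have fp2 : rnorm (f - p)^* <= 1 / 200 by rewrite rnorm_star.
  have := rnormD_le (rnormD_le (rnormM_le fp1 fp2) (rnormM_le fp1 p1))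
    (rnormM_le p1 fp2).
  lra.
have [|g [/= [pg gp] Bg] [gg gp1]] := newton_idempotent CB pp p1 hI ffp1; first by lra.
suff : p - g = 0 by move/eqP; rewrite subr_eq0 => /eqP ->.
apply: idempotent_small; first by rewrite !cmulE pp gg pg gp; lmod.
by rewrite rnormC; lra.
Qed.

End Idempotents.

(** * Rapidly decreasing sums *)

Section CountableSums.
Variables (R : realType) (A : cstarAlgType R) (eta : R) (I : Type).
Variable m : I -> nat.
Hypotheses (eta0 : 0 < eta) (eta2 : eta <= 2^-1) (m_inj : injective m).
Implicit Types (f g : I -> A) (S a b : A) (C r : R).

Let eta01 : 0 <= eta <= 2^-1. Proof. by rewrite (ltW eta0). Qed.

Definition term f k : A :=
  if pselect (exists i, m i = k) is left ex then f (projT1 (cid ex)) else 0.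

Lemma termE f i : term f (m i) = f i.
Proof.
rewrite /term; case: pselect => [ex|[]]; last by exists i.
by congr f; apply: m_inj; rewrite (projT2 (cid ex)).
Qed.

Lemma term_cases f k : term f k = 0 \/ exists i, k = m i /\ term f k = f i.
Proof.
rewrite /term; case: pselect => [ex|]; last by left.
by right; exists (projT1 (cid ex)); rewrite (projT2 (cid ex)).
Qed.

Definition psum f n := \sum_(0 <= k < n) term f k.

Definition summable f S :=
  forall r, 0 < r -> exists n, forall k, (n <= k)%N -> rnorm (S - psum f k) <= r.

Definition csum f : A := xget 0 [set S | summable f S].

Definition dominated f := exists C, forall i, rnorm (f i) <= C * eta ^+ m i.

Lemma summable_unique f S S' : summable f S -> summable f S' -> S = S'.
Proof.
move=> fS fS'; apply/eqP; rewrite -subr_eq0; apply/eqP; apply: rnorm_le0 => r r0.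
have [|n nS] := fS (r / 2); first by rewrite divr_gt0.
have [|n' nS'] := fS' (r / 2); first by rewrite divr_gt0.
pose k := maxn n n'.
have -> : S - S' = (S - psum f k) - (S' - psum f k) by lmod.
have := rnormB_le (nS k (leq_maxl _ _)) (nS' k (leq_maxr _ _)); lra.
Qed.

Lemma csum_eq f S : summable f S -> csum f = S.
Proof.
move=> fS; apply: (summable_unique _ fS).
by have := @xgetPex _ 0 [set S | summable f S]; apply; exists S.
Qed.

Lemma dominated_term f C : 0 <= C -> (forall i, rnorm (f i) <= C * eta ^+ m i) ->
  forall k, rnorm (term f k) <= C * eta ^+ k.
Proof.
move=> C0 fC k; have [->|[i [-> ->]]//] := term_cases f k.
by rewrite rnorm0 mulr_ge0// exprn_ge0// ltW.
Qed.

Lemma csumP f : dominated f -> summable f (csum f).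
Proof.
move=> [C fC].
have fC' i : rnorm (f i) <= `|C| * eta ^+ m i.
  by apply: le_trans (fC i) _; rewrite ler_wpM2r ?ler_norm// exprn_ge0// ltW.
have [S fS] := series_exists eta01 (dominated_term (normr_ge0 C) fC').
have sS : summable f S.
  move=> r r0; have [n nr] := geometric_small (2 * `|C|) eta01 r0.
  by exists n => k nk; apply: le_trans (fS k) (nr k nk).
by rewrite (csum_eq sS).
Qed.

Lemma csum_norm f C n : 0 <= C -> (forall i, rnorm (f i) <= C * eta ^+ m i) ->
  (forall i, (m i < n)%N -> f i = 0) -> rnorm (csum f) <= 2 * C * eta ^+ n.
Proof.
move=> C0 fC f0; apply/ler_addgt0Pl => e e0.
have [k kS] := csumP (ex_intro _ C fC) e0.
have kn : (n <= maxn k n)%N by rewrite leq_maxr.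
have -> : csum f = (csum f - psum f (maxn k n)) + psum f (maxn k n) by lmod.
apply: rnormD_le; first by rewrite kS// leq_maxl.
rewrite /psum (big_cat_nat _ kn)//= big_nat big1 ?add0r.
  rewrite -(subnKC kn).
  by apply: (partial_sum_tail eta01); apply: dominated_term.
move=> j /= jn; have [//|[i [ji ->]]] := term_cases f j.
by rewrite f0// -ji.
Qed.

Lemma csum_map (F : A -> A) f C : (forall x y, F (x + y) = F x + F y) ->
  (forall x, rnorm (F x) <= C * rnorm x) -> dominated f ->
  F (csum f) = csum (fun i => F (f i)).
Proof.
move=> FD FC fd.
have FZ : F 0 = 0 by apply: (addrI (F 0)); rewrite -FD !addr0.
have FN x : F (- x) = - F x by apply: (addrI (F x)); rewrite -FD !subrr.
have Ft k : term (fun i => F (f i)) k = F (term f k).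
  by rewrite /term; case: pselect.
symmetry; apply: csum_eq => r r0.
have C1 : 0 < `|C| + 1 by rewrite ltr_wpDl.
have [|n nS] := csumP fd (_ : 0 < r / (`|C| + 1)); first by rewrite divr_gt0.
exists n => k /nS kS.
have -> : F (csum f) - psum (fun i => F (f i)) k = F (csum f - psum f k).
  rewrite FD FN; congr (_ - _); rewrite /psum (big_morph F FD FZ).
  by apply: eq_bigr => j _; rewrite Ft.
apply: le_trans (FC _) _.
apply: le_trans (_ : (`|C| + 1) * rnorm (csum f - psum f k) <= _).
  by rewrite ler_wpM2r ?rnorm_ge0//; have := ler_norm C; lra.
by rewrite -ler_pdivlMl// mulrC.
Qed.

Lemma csum_mull f a : dominated f -> a ** csum f = csum (fun i => a ** f i).
Proof.
by apply: (@csum_map (fun x => a ** x) f (rnorm a)) => *; rewrite ?cmulDr ?rnormM.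
Qed.

Lemma csum_mulr f a : dominated f -> csum f ** a = csum (fun i => f i ** a).
Proof.
apply: (@csum_map (fun x => x ** a) f (rnorm a)) => *; rewrite ?cmulDl//.
by rewrite mulrC rnormM.
Qed.

Lemma csum_star f : dominated f -> (csum f)^* = csum (fun i => (f i)^*).
Proof.
apply: (@csum_map (fun x => x^*) f 1) => *; rewrite ?cstarD//.
by rewrite rnorm_star mul1r.
Qed.

Lemma csum_single f j : (forall i, i <> j -> f i = 0) -> csum f = f j.
Proof.
move=> fj; apply: csum_eq => r r0; exists (m j).+1 => k jk.
rewrite /psum (big_cat_nat _ jk)//= big_nat_recr//= termE !big_nat !big1 ?add0r ?addr0.
- by rewrite subrr rnorm0 ltW.
- move=> i /andP[ji _]; have [//|[i' [ii' ->]]] := term_cases f i.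
  by apply: fj => i'j; rewrite ii' i'j ltnn in ji.
- move=> i ij; have [//|[i' [ii' ->]]] := term_cases f i.
  by apply: fj => i'j; rewrite ii' i'j ltnn in ij.
Qed.

Lemma csum0 f : (forall i, f i = 0) -> csum f = 0.
Proof.
move=> f0; apply: csum_eq => r r0; exists 0%N => k _.
rewrite /psum big1 ?subrr ?rnorm0 ?ltW// => i _.
by have [//|[j [_ ->]]] := term_cases f i.
Qed.

Lemma csumB f g : dominated f -> dominated g ->
  csum (fun i => f i - g i) = csum f - csum g.
Proof.
move=> fd gd; apply: csum_eq => r r0.
have [|n nS] := csumP fd (_ : 0 < r / 2); first by rewrite divr_gt0.
have [|n' nS'] := csumP gd (_ : 0 < r / 2); first by rewrite divr_gt0.
exists (maxn n n') => k; rewrite geq_max => /andP[/nS kf /nS' kg].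
have -> : psum (fun i => f i - g i) k = psum f k - psum g k.
  rewrite /psum -sumrB; apply: eq_bigr => i _.
  by rewrite /term; case: pselect => //; rewrite subr0.
have -> : csum f - csum g - (psum f k - psum g k) =
  (csum f - psum f k) - (csum g - psum g k) by lmod.
have := rnormB_le kf kg; lra.
Qed.

Lemma csum_mem (V : set A) f : V 0 -> (forall x y, V x -> V y -> V (x + y)) ->
  (forall a, (forall r, 0 < r -> exists2 b, V b & rnorm (a - b) <= r) -> V a) ->
  dominated f -> (forall i, V (f i)) -> V (csum f).
Proof.
move=> V0 VD Vcl fd Vf; apply: Vcl => r r0.
have [n nS] := csumP fd r0; exists (psum f n); last exact: nS.
rewrite /psum; apply: (big_ind V) => // i _.
by have [->|[j [_ ->]]] := term_cases f i.
Qed.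

Lemma csum_dominated_le f g C : (forall i, rnorm (f i) <= C * rnorm (g i)) -> 0 <= C ->
  dominated g -> dominated f.
Proof.
move=> fg C0 [C' gC]; exists (C * C') => i.
by apply: le_trans (fg i) _; rewrite -mulrA ler_wpM2l.
Qed.

Lemma csumD1 f j : dominated f ->
  csum f = f j + csum (fun i => if `[< i = j >] then 0 else f i).
Proof.
move=> fd.
pose g i := if `[< i = j >] then f i else 0.
have gd : dominated g.
  apply: (@csum_dominated_le g f 1) => // i; rewrite mul1r /g.
  by case: asboolP => // _; rewrite rnorm0 rnorm_ge0.
have -> : (fun i => if `[< i = j >] then 0 else f i) = (fun i => f i - g i).
  by apply/funext => i; rewrite /g; case: asboolP => _; rewrite ?subrr ?subr0.
rewrite csumB// (@csum_single g j); last first.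
  by move=> i ij; rewrite /g; case: asboolP.
by rewrite /g; case: asboolP => // _; rewrite addrC subrK.
Qed.

End CountableSums.

(** * Cuntz-Krieger relations *)

Section CuntzKrieger.
Variables (R : realType) (E : digraph) (A : cstarAlgType R).
Variables (p : vertex E -> A) (s : edge E -> A).
Hypothesis hCK : CK_family p s.
Implicit Types (u v w : vertex E) (e f : edge E).

Local Notation q e := (s e ** (s e)^*).

Lemma CK_star_p v : (p v)^* = p v. Proof. by case: (CK_proj hCK v). Qed.

Lemma CK_pp u v : p u ** p v = if u == v then p u else 0.
Proof.
case: eqVneq => [<-|/eqP uv]; first by case: (CK_proj hCK u).
exact: CK_proj_orth hCK _ _ uv.
Qed.

Lemma CK_norm_p v : rnorm (p v) <= 1.
Proof. exact/projection_norm/(CK_proj hCK). Qed.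

Lemma CK_norm_s e : rnorm (s e) <= 1.
Proof.
have := rnorm_starM (s e); rewrite (CK_source hCK) => se.
by have := CK_norm_p (esource e); have := rnorm_ge0 (s e); nra.
Qed.

Lemma CK_sp e v : s e ** p v = if esource e == v then s e else 0.
Proof.
have se : s e = s e ** p (esource e).
  by rewrite -(CK_source hCK) cmulA (CK_piso hCK).
rewrite {1}se -cmulA CK_pp; case: eqP => _; last exact: cmul0r.
by rewrite -se.
Qed.

Lemma CK_proj_q e : projection (q e).
Proof. by split; rewrite ?cstarM ?cstarK// cmulA (CK_piso hCK). Qed.

Lemma CK_qs e f : q e ** s f = if e == f then s e else 0.
Proof.
case: eqVneq => [<-|/eqP ef]; first exact: CK_piso hCK e.
have <- : q f ** s f = s f by exact: CK_piso hCK f.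
by rewrite cmulA (CK_range_orth hCK ef) cmul0l.
Qed.

Lemma subprojection_absorb (a b : A) : projection a -> projection b -> cle a b ->
  b ** a = a.
Proof.
move=> [aa as_] [bb bs] [c cE].
suff : a - a ** b = 0.
  by move/eqP; rewrite subr_eq0 => /eqP ab; have := cstarM a b; rewrite -ab bs as_.
apply: (@starM_add_eq0 _ _ _ (c - c ** b)).
have bbr x : x ** b ** b = x ** b by rewrite -cmulA bb.
have aar x : x ** a ** a = x ** a by rewrite -cmulA aa.
have ccr x : x ** c^* ** c = x ** b - x ** a by rewrite -cmulA -cE cmulBr.
have cc : c^* ** c = b - a by [].
rewrite !cstarE as_ bs !cmulE aa ?aar ?cc ?ccr !cmulE ?bb ?bbr; lmod.
Qed.

Lemma CK_ps v e : p v ** s e = if erange e == v then s e else 0.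
Proof.
have rs : p (erange e) ** s e = s e.
  have := subprojection_absorb (CK_proj_q e) (CK_proj hCK (erange e)) (CK_range hCK e).
  by move=> pq; rewrite -{1}(CK_piso hCK e) cmulA pq (CK_piso hCK).
by rewrite -{1}rs cmulA CK_pp eq_sym; case: eqP => [<-|_] //; exact: cmul0l.
Qed.

End CuntzKrieger.

(** * The generator *)

Definition dead (E : digraph) (w : vertex E) := forall e : edge E, esource e <> w.

(* The enumeration places some dead target of a vertex [v], if there is one,
   before every edge with source [v]: the projection of that target is recovered
   first and is then used to recover [p v]. *)
Lemma exists_order (E : digraph) : exists m : edge E + vertex E -> nat,
  injective m /\ forall e f : edge E, esource f = esource e -> dead (erange f) ->
    exists f' : edge E, [/\ esource f' = esource e, dead (erange f') &
      (m (inr (erange f')) < m (inl e))%N].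
Proof.
pose target v w := dead w /\ exists2 f : edge E, esource f = v & erange f = w.
pose I := (edge E + vertex E)%type.
pose ex (i : I) := match i with
  | inl e => if pselect (exists w, target (esource e) w) is left h
             then (pickle (inr (projT1 (cid h)) : I)).+1 else 0
  | inr _ => 0
  end%N.
pose m i := (2 ^ pickle i * 3 ^ ex i)%N; exists m; split=> [i j|e f fe fd].
  move=> /(congr1 (logn 2)); rewrite /m !lognM ?expn_gt0// !lognX.
  by rewrite !muln1 !muln0 !addn0 => /(pcan_inj pickleK).
have [w ew [wd [f' f'e f'w]]] : exists2 w,
    ex (inl e) = (pickle (inr w : I)).+1 & target (esource e) w.
  rewrite /ex; case: pselect => [h|[]]; last by exists (erange f); split=> //; exists f.
  by exists (projT1 (cid h)) => //; apply: projT2 (cid h).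
exists f'; rewrite f'w; split=> //.
rewrite /m ew /= expn0 muln1; set k := pickle _; set l := pickle _.
apply: (@leq_trans (3 ^ k.+1)); last by rewrite leq_pmull// expn_gt0.
by rewrite (@leq_ltn_trans (3 ^ k))// ?leq_exp2r ?ltn_exp2l//; case: k.
Qed.

Section Generator.
Variables (R : realType) (E : digraph) (A : cstarAlgType R).
Variables (p : vertex E -> A) (s : edge E -> A).
Hypothesis hCK : CK_family p s.
Variables (eta : R) (m : edge E + vertex E -> nat).
Hypotheses (eta0 : 0 < eta) (eta6 : eta <= 1000^-1 * 1000^-1) (m_inj : injective m).
Implicit Types (u v w : vertex E) (e f : edge E) (i j : edge E + vertex E).
Implicit Types (P : vertex E -> Prop) (a b : A).

Local Notation q e := (s e ** (s e)^*).

Let eta2 : eta <= 2^-1. Proof. by have := eta6; lra. Qed.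

Let etaX n : 0 < eta ^+ n. Proof. exact: exprn_gt0. Qed.

Let etaXC n : (eta ^+ n)%:C != 0 :> R[i].
Proof. by rewrite -(rmorph0 (real_complex R)) (inj_eq (@complexI R)) gt_eqF. Qed.

(* The generator is [X + X D], with [X = total] and [D = diag] below.  The sum
   [X] runs over the edges and the dead vertices, where an edge contributes [s e]
   and a dead vertex [p w], as if it carried a loop; the types are summed so that
   a single numbering [m] fixes all the sizes. *)
Definition src i := match i with inl e => esource e | inr w => w end.

Definition summand i : A := match i with
  | inl e => (eta ^+ m i)%:C *: s e
  | inr w => if `[< dead w >] then (eta ^+ m i)%:C *: p w else 0
  end.

Definition selected P i := if `[< P (src i) >] then summand i else 0.

Definition part P := csum m (selected P).

Definition column v := part (eq^~ v).

Lemma summand_p i v : summand i ** p v = if src i == v then summand i else 0.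
Proof.
case: i => [e|w] /=.
  by rewrite cmulZl (CK_sp hCK); case: eqP => // _; rewrite scaler0.
case: asboolP => _; last by rewrite cmul0l if_same.
by rewrite cmulZl (CK_pp hCK); case: eqP => // _; rewrite scaler0.
Qed.

Lemma summand_norm i : rnorm (summand i) <= eta ^+ m i.
Proof.
have small a : rnorm a <= 1 -> rnorm ((eta ^+ m i)%:C *: a) <= eta ^+ m i.
  by move=> a1; rewrite rnormZ gtr0_norm// ler_piMr// ltW.
case: i small => [e|w] small /=; first exact/small/(CK_norm_s hCK).
case: asboolP => _; last by rewrite rnorm0 ltW.
exact/small/(CK_norm_p hCK).
Qed.

Lemma selected_norm P i : rnorm (selected P i) <= 1 * eta ^+ m i.
Proof.
rewrite mul1r /selected; case: asboolP => _; first exact: summand_norm.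
by rewrite rnorm0 ltW.
Qed.

Lemma selected_dominated P : dominated eta m (selected P).
Proof. by exists 1; apply: selected_norm. Qed.

Lemma part_p P v : part P ** p v = if `[< P v >] then column v else 0.
Proof.
rewrite /part (csum_mulr eta0 eta2 _ (selected_dominated P)).
case: asboolP => Pv; last first.
  apply: csum0 => i; rewrite /selected; case: asboolP => Pi; last exact: cmul0l.
  by rewrite summand_p; case: eqP => // iv; case: Pv; rewrite -iv.
congr csum; apply/funext => i; rewrite /selected /=.
case: (asboolP (src i = v)) => iv.
  by rewrite iv asboolT// summand_p iv eqxx.
case: asboolP => Pi; last exact: cmul0l.
by rewrite summand_p; case: eqP.
Qed.

Lemma column_dead w : dead w -> column w = (eta ^+ m (inr w))%:C *: p w.
Proof.
move=> dw; rewrite /column /part (csum_single m_inj (j := inr w)).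
  by rewrite /selected /= !asboolT.
move=> [e|v] iw; rewrite /selected /=; case: asboolP => // eqw.
  by have := dw e.
by case: iw; rewrite eqw.
Qed.

Lemma q_part P e : ~ (dead (erange e) /\ P (erange e)) ->
  q e ** part P = if `[< P (esource e) >] then (eta ^+ m (inl e))%:C *: s e else 0.
Proof.
move=> eP; rewrite /part (csum_mull eta0 eta2 _ (selected_dominated P)).
rewrite (csum_single m_inj (j := inl e)).
  rewrite /selected /=; case: asboolP => _; last exact: cmul0r.
  by rewrite cmulZr (CK_qs hCK) eqxx.
move=> [f|w] ie; rewrite /selected /=; case: asboolP => Pi; rewrite ?cmul0r//.
  rewrite cmulZr (CK_qs hCK); case: eqP => [ef|_]; last exact: scaler0.
  by case: ie; rewrite ef.
case: asboolP => dw; last exact: cmul0r.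
rewrite cmulZr -cmulA -(CK_star_p hCK) -cstarM (CK_ps hCK).
case: eqP => [ew|_]; last by rewrite cstar0 cmul0r scaler0.
by case: eP; rewrite ew; split.
Qed.

Lemma star_s_part P e : ~ (dead (erange e) /\ P (erange e)) ->
  (s e)^* ** part P =
    if `[< P (esource e) >] then (eta ^+ m (inl e))%:C *: p (esource e) else 0.
Proof.
move=> eP; have -> : (s e)^* = (s e)^* ** q e.
  by rewrite -{1}(CK_piso hCK e) !cstarE cmulA.
rewrite -cmulA (q_part eP); case: asboolP => _; last exact: cmul0r.
by rewrite cmulZr (CK_source hCK).
Qed.

Definition multiple v : set A := [set a | a = (rnorm a)%:C *: p v].

Lemma multiple_scale v (r : R) : 0 <= r -> multiple v (r%:C *: p v).
Proof.
move=> r0; rewrite /multiple /= rnormZ ger0_norm//.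
have [pp ps] := CK_proj hCK v.
have := rnorm_starM (p v); rewrite ps pp => /eqP.
rewrite expr2 -subr_eq0 -{1}[rnorm _]mul1r -mulrBl mulf_eq0 => /orP[|/eqP p0].
  by rewrite subr_eq0 => /eqP <-; rewrite mulr1.
by rewrite (rnorm_eq0 p0) !scaler0.
Qed.

Lemma multipleD v a b : multiple v a -> multiple v b -> multiple v (a + b).
Proof.
move=> ma mb; have -> : a + b = (rnorm a + rnorm b)%:C *: p v.
  by rewrite {1}ma {1}mb -scalerDl -rmorphD.
by apply: multiple_scale; rewrite addr_ge0// rnorm_ge0.
Qed.

Lemma multiple_closed v a :
  (forall r, 0 < r -> exists2 b, multiple v b & rnorm (a - b) <= r) -> multiple v a.
Proof.
move=> ar; apply/eqP; rewrite -subr_eq0; apply/eqP; apply: rnorm_le0 => r r0.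
have [|b mb ab] := ar (r / 2); first by rewrite divr_gt0.
have -> : a - (rnorm a)%:C *: p v = (a - b) - (rnorm a - rnorm b)%:C *: p v.
  by rewrite {1}mb; lmod.
have nab : `|rnorm a - rnorm b| <= rnorm (a - b).
  rewrite ler_norml; apply/andP; split.
    by have := rnormD (b - a) a; rewrite subrK rnormC; lra.
  by have := rnormD (a - b) b; rewrite subrK; lra.
apply: le_trans (rnormB_le ab (_ : _ <= r / 2)) _; last by lra.
rewrite rnormZ; apply: le_trans (ler_pM _ _ nab (CK_norm_p hCK v)) _ => //.
  exact: rnorm_ge0.
by rewrite mulr1.
Qed.

Lemma column_starM v : multiple v ((column v)^* ** column v).
Proof.
have [dv|ndv] := pselect (dead v).
  rewrite column_dead// cstarZr (CK_star_p hCK) !cmulE (CK_pp hCK) eqxx scalerA.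
  by rewrite -rmorphM/=; apply: multiple_scale; rewrite mulr_ge0// ltW.
rewrite [X in _ ** X]/column /part (csum_mull eta0 eta2 _ (selected_dominated _)).
have z0 : multiple v 0 by rewrite /multiple /= rnorm0 scale0r.
apply: (csum_mem eta0 eta2 z0 (@multipleD v) (@multiple_closed v)).
  apply: (csum_dominated_le (g := selected (eq^~ v)) (C := rnorm (column v)^*)) => //.
  - by move=> i; apply: rnormM.
  - exact: rnorm_ge0.
  - exact: selected_dominated.
move=> [e|w]; rewrite /selected /=; case: asboolP => [ev|_]; rewrite ?cmul0r//.
  have -> : (column v)^* ** ((eta ^+ m (inl e))%:C *: s e) =
      ((eta ^+ m (inl e) * eta ^+ m (inl e))%:C *: p v).
    rewrite cmulZr -[_ ** s e]cstarK cstarM cstarK star_s_part; last first.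
      by move=> [+ re]; rewrite re.
    by rewrite ev asboolT// cstarZr (CK_star_p hCK) scalerA -rmorphM.
  by apply: multiple_scale; rewrite mulr_ge0// ltW.
by rewrite asboolF ?cmul0r// ev.
Qed.

Lemma column_eq0 v : column v = 0 -> p v = 0.
Proof.
have ep n : (eta ^+ n)%:C *: p v = 0 -> p v = 0.
  by move/eqP; rewrite scaler_eq0 (negPf (etaXC n)) => /eqP.
have [dv|ndv] := pselect (dead v); first by rewrite column_dead// => /ep.
have [e ev] : exists e, esource e = v.
  by apply: contrapT => nev; apply: ndv => e ev; apply: nev; exists e.
move=> c0; have := @star_s_part (eq^~ v) e; rewrite -/(column v) c0 cmul0r ev asboolT//.
move=> /(_ _)/esym/ep; apply.
by move=> [+ re]; rewrite re.
Qed.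

End Generator.

(** * Recovering the family *)

Section Membership.
Variables (R : realType) (E : digraph) (A : cstarAlgType R).
Variables (p : vertex E -> A) (s : edge E -> A).
Hypothesis hCK : CK_family p s.
Variables (eta : R) (m : edge E + vertex E -> nat).
Hypotheses (eta0 : 0 < eta) (eta6 : eta <= 1000^-1 * 1000^-1) (m_inj : injective m).
Hypothesis m_dead : forall e f : edge E, esource f = esource e -> dead (erange f) ->
    exists f' : edge E, [/\ esource f' = esource e, dead (erange f') &
      (m (inr (erange f')) < m (inl e))%N].
Implicit Types (u v w : vertex E) (e f : edge E) (i j : edge E + vertex E).
Implicit Types (P : vertex E -> Prop) (a b : A).

Local Notation q e := (s e ** (s e)^*).

Let eta2 : eta <= 2^-1. Proof. by have := eta6; lra. Qed.

Let etaX n : 0 < eta ^+ n. Proof. exact: exprn_gt0. Qed.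

Let etaX1 n : eta ^+ n <= 1.
Proof. by rewrite exprn_ile1 ?(ltW eta0)//; have := eta2; lra. Qed.

Let etaXC n : (eta ^+ n)%:C != 0 :> R[i].
Proof. by rewrite -(rmorph0 (real_complex R)) (inj_eq (@complexI R)) gt_eqF. Qed.

Let pickle_inj : injective (pickle : edge E -> nat) := pcan_inj pickleK.

Let norm_q e : rnorm (q e) <= 1.
Proof. exact/projection_norm/(CK_proj_q hCK). Qed.

Definition weight e : R := eta ^+ (pickle e).+1.

Let weight0 e : 0 < weight e. Proof. exact: etaX. Qed.

Let weight1 e : weight e <= 1. Proof. exact: etaX1. Qed.

Definition diag_summand e : A := (weight e)%:C *: q e.

Definition diag : A := csum pickle diag_summand.

Lemma diag_summand_norm e : rnorm (diag_summand e) <= eta * eta ^+ pickle e.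
Proof.
by rewrite rnormZ gtr0_norm// /weight exprS ler_piMr// mulr_ge0// ltW.
Qed.

Lemma diag_dominated : dominated eta pickle diag_summand.
Proof. by exists eta; apply: diag_summand_norm. Qed.

Lemma diag_norm : rnorm diag <= 2 * eta.
Proof.
have := @csum_norm _ _ _ _ _ eta0 eta2 diag_summand eta 0 (ltW eta0) diag_summand_norm.
by rewrite expr0 mulr1 => ->.
Qed.

Lemma diag_star : diag^* = diag.
Proof.
rewrite /diag (csum_star eta0 eta2 diag_dominated); congr csum.
by apply/funext => e; rewrite /diag_summand !cstarE.
Qed.

Lemma CK_qq e f : q e ** q f = if e == f then q e else 0.
Proof.
case: eqP => [<-|ef]; first by case: (CK_proj_q hCK e).
exact: CK_range_orth hCK _ _ ef.
Qed.

Lemma CK_qp e v : q e ** p v = if erange e == v then q e else 0.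
Proof.
rewrite -cmulA -(CK_star_p hCK) -cstarM (CK_ps hCK).
by case: eqP => // _; rewrite cstar0 cmul0r.
Qed.

Lemma CK_pq e v : p v ** q e = if erange e == v then q e else 0.
Proof. by rewrite cmulA (CK_ps hCK); case: eqP => // _; rewrite cmul0l. Qed.

Lemma diag_q e : diag ** q e = (weight e)%:C *: q e.
Proof.
rewrite /diag (csum_mulr eta0 eta2 _ diag_dominated).
rewrite (csum_single pickle_inj (j := e)).
  by rewrite /diag_summand cmulZl CK_qq eqxx.
move=> f fe; rewrite /diag_summand cmulZl CK_qq.
by case: eqP fe => // _ _; rewrite scaler0.
Qed.

Lemma diag_p v : diag ** p v = p v ** diag.
Proof.
rewrite /diag (csum_mulr eta0 eta2 _ diag_dominated).
rewrite (csum_mull eta0 eta2 _ diag_dominated); congr csum; apply/funext => e.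
by rewrite /diag_summand cmulZl cmulZr CK_qp CK_pq.
Qed.

(* [p v + corner_diag v] is [(1 + D) p_v (1 + D)], since [D] commutes with [p v];
   up to a scalar this is the square of the modulus of [(X + X D) p_v]. *)
Definition corner_diag v : A := 2%:C *: (diag ** p v) + diag ** (diag ** p v).

Definition corner_weight e : R := 2 * weight e + weight e ^+ 2.

Definition corner_summand v n e : A :=
  if `[< erange e = v /\ (n <= pickle e)%N >] then (corner_weight e)%:C *: q e else 0.

Definition corner_tail v n : A := csum pickle (corner_summand v n).

Let corner_weight_gt0 e : 0 < corner_weight e.
Proof. by rewrite addr_gt0// ?exprn_gt0// mulr_gt0. Qed.

Lemma corner_summand_norm v n e :
  rnorm (corner_summand v n e) <= 3 * eta * eta ^+ pickle e.
Proof.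
rewrite /corner_summand; case: asboolP => _; last first.
  by rewrite rnorm0 !mulr_ge0 ?ltW.
rewrite rnormZ gtr0_norm//.
apply: le_trans (_ : corner_weight e <= _).
  by rewrite ler_piMr// ltW.
rewrite -mulrA -exprS -/(weight e) /corner_weight.
by have := weight1 e; have := weight0 e; nra.
Qed.

Lemma corner_diagE v : corner_diag v = corner_tail v 0.
Proof.
pose F a := 2%:C *: (a ** p v) + diag ** (a ** p v).
transitivity (csum pickle (fun e => F (diag_summand e))).
  apply: (@csum_map _ _ _ _ pickle eta0 eta2 F diag_summand (2 + rnorm diag)).
  - by move=> x y; rewrite /F !cmulE; lmod.
  - have xp x : rnorm (x ** p v) <= rnorm x.
      by rewrite -[leRHS]mulr1; apply: rnormM_le => //; exact: (CK_norm_p hCK).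
    move=> x; rewrite mulrDl; apply: rnormD_le; last exact: rnormM_le.
    by rewrite rnormZ ger0_norm// ler_wpM2l.
  - exact: diag_dominated.
congr csum; apply/funext => e; rewrite /F /diag_summand /corner_summand.
rewrite cmulZl CK_qp; case: eqP => er; last first.
  by rewrite asboolF ?scaler0 ?cmul0r ?addr0// => -[].
rewrite asboolT// cmulZr diag_q !scalerA -scalerDl -!rmorphM -rmorphD/=.
by rewrite /corner_weight expr2.
Qed.

Lemma corner_dominated v n : dominated eta pickle (corner_summand v n).
Proof. by exists (3 * eta); apply: corner_summand_norm. Qed.

Lemma corner_tailS v e : erange e = v ->
  corner_tail v (pickle e) =
    (corner_weight e)%:C *: q e + corner_tail v (pickle e).+1.
Proof.
move=> ev; rewrite /corner_tail.
rewrite (csumD1 eta0 eta2 pickle_inj e (corner_dominated _ _)).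
congr (_ + _); first by rewrite /corner_summand asboolT.
congr csum; apply/funext => f; rewrite /corner_summand.
case: asboolP => [->|fe]; first by rewrite asboolF// ltnn => -[].
congr (if _ then _ else _); apply: asbool_equiv_eq.
split=> [[fv]|[fv /ltnW//]]; rewrite leq_eqVlt => /predU1P[/pickle_inj ef|//].
by case: fe.
Qed.

Lemma corner_tail_q v e n : erange e = v -> n = pickle e ->
  corner_tail v n ** q e = (corner_weight e)%:C *: q e.
Proof.
move=> ev ->; rewrite /corner_tail (csum_mulr eta0 eta2 _ (corner_dominated _ _)).
rewrite (csum_single pickle_inj (j := e)).
  by rewrite /corner_summand asboolT// cmulZl CK_qq eqxx.
move=> f fe; rewrite /corner_summand; case: asboolP; rewrite ?cmul0l// => _.
by rewrite cmulZl CK_qq; case: eqP fe => // _ _; rewrite scaler0.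
Qed.

Variable B : set A.
Hypotheses (BB : closed_subalgebra B) (Bs : forall x, B x -> B x^*).

Let B0 : B 0. Proof. by case: BB. Qed.
Let BD x y : B x -> B y -> B (x + y). Proof. by case: BB => _ BD *; apply: BD. Qed.
Let BZ (k : R[i]) x : B x -> B (k *: x).
Proof. by case: BB => _ _ BZ *; apply: BZ. Qed.
Let BM x y : B x -> B y -> B (x ** y).
Proof. by case: BB => _ _ _ BM *; apply: BM. Qed.
Let BS x y : B x -> B y -> B (x - y). Proof. exact: closed_subalgebraB. Qed.
Let BZV (k : R[i]) x : k != 0 -> B (k *: x) -> B x.
Proof. by move=> k0 /(BZ k^-1); rewrite scalerA mulVf// scale1r. Qed.

Lemma mem_q_of_corner v : B (corner_diag v) -> forall e, erange e = v -> B (q e).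
Proof.
rewrite corner_diagE => Bv.
suff H n : B (corner_tail v n) /\
    forall e, erange e = v -> (pickle e < n)%N -> B (q e).
  by move=> e ev; have [_] := H (pickle e).+1; apply.
elim: n => [|n [Bn Bq]]; first by split.
have [[e ev en]|ne] := pselect (exists2 e, erange e = v & pickle e = n); last first.
  split=> [|e ev]; last first.
    by rewrite ltnS leq_eqVlt => /predU1P[en|/Bq]; [case: ne; exists e|apply].
  suff -> : corner_tail v n.+1 = corner_tail v n by [].
  congr csum; apply/funext => e; rewrite /corner_summand.
  congr (if _ then _ else _); apply: asbool_equiv_eq.
  split=> [[ev /ltnW//]|[ev]]; rewrite leq_eqVlt => /predU1P[en|//].
  by case: ne; exists e.
have cq := corner_tail_q ev (esym en).
have qB : B (q e).
  apply: (projection_mem BB Bs (CK_proj_q hCK e)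
    (z := ((corner_weight e)^-1)%:C *: corner_tail v n)).
  - exact: BZ.
  - have zq (Q T : A) (k c : R[i]) : Q ** Q = Q -> T ** Q = c *: Q ->
      (k *: T) ** Q = Q ** (k *: T) ** Q.
      by move=> QQ TQ; rewrite -cmulA !cmulZl TQ !cmulZr QQ.
    by apply: zq cq; case: (CK_proj_q hCK e).
  rewrite -en (corner_tailS ev) scalerDr scalerA -rmorphM mulVf ?gt_eqF// scale1r.
  rewrite addrAC subrr add0r rnormZ gtr0_norm ?invr_gt0// ler_pdivrMl//.
  have e3 : 0 <= 3 * eta by rewrite mulr_ge0// ltW.
  apply: le_trans (csum_norm eta0 eta2 (n := (pickle e).+1) e3
    (corner_summand_norm v (pickle e).+1) _) _.
    by move=> f fe; rewrite /corner_summand asboolF// => -[_]; rewrite leqNgt fe.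
  rewrite -/(weight e) /corner_weight; have := weight0 e; have := eta6.
  move: (weight e) => x e6 x0.
  have : eta * x <= 1000^-1 * 1000^-1 * x by rewrite ler_pM2r.
  have : 0 < x ^+ 2 by rewrite exprn_gt0.
  lra.
split.
  have -> : corner_tail v n.+1 = corner_tail v n - (corner_weight e)%:C *: q e.
    by rewrite -en (corner_tailS ev) addrAC subrr add0r.
  by apply/BS/BZ.
move=> f fv; rewrite ltnS leq_eqVlt => /predU1P[fn|]; last exact: Bq.
by have /pickle_inj -> : pickle f = pickle e by rewrite fn.
Qed.

Definition total : A := part p s eta m (fun=> True).

Hypothesis Bx : B (total + total ** diag).

Let total_p v : total ** p v = column p s eta m v.
Proof. by rewrite (part_p hCK m eta0 eta6) asboolT. Qed.

Lemma mem_corner v : B (p v) -> B (corner_diag v).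
Proof.
move=> Bp; set Y := column p s eta m v.
have Yp : (total + total ** diag) ** p v = Y + Y ** diag.
  by rewrite cmulDl -cmulA diag_p cmulA !total_p.
have BY : B (Y + Y ** diag) by rewrite -Yp; exact: BM.
pose al := rnorm (Y^* ** Y).
have YE : Y^* ** Y = al%:C *: p v by exact: (column_starM hCK eta0 eta6 m_inj v).
have BYY : B (al%:C *: (p v + corner_diag v)).
  have := BM (Bs BY) BY.
  have -> : (Y + Y ** diag)^* ** (Y + Y ** diag) =
      Y^* ** Y + Y^* ** Y ** diag + diag ** (Y^* ** Y) + diag ** (Y^* ** Y ** diag).
    by rewrite !cstarE diag_star !cmulE; lmod.
  rewrite YE; congr B; rewrite /corner_diag !cmulZl !cmulZr -diag_p; lmod.
have [al0|aln] := eqVneq al 0.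
  have Y0 : Y = 0 by apply: starM_eq0; rewrite YE al0 scale0r.
  have p0 : p v = 0 by apply: (column_eq0 hCK eta0 eta6 m_inj Y0).
  by rewrite /corner_diag p0 !cmul0r scaler0 addr0.
have alC : al%:C != 0 :> R[i].
  by rewrite -(rmorph0 (real_complex R)) (inj_eq (@complexI R)).
have := BS (BZV alC BYY) Bp; congr B; lmod.
Qed.

Lemma mem_q e : B (p (erange e)) -> B (q e).
Proof. by move=> /mem_corner/mem_q_of_corner; apply. Qed.

Definition known n u := exists i,
  [/\ (if i is inr w then dead w else True), (m i < n)%N & src i = u].

Definition rest n : A := part p s eta m (fun u => ~ known n u).

Lemma star_near a b (r : R) : rnorm (a - b) <= r -> rnorm b <= 1 -> 0 <= r <= 1 ->
  rnorm (a^* ** a - b^* ** b) <= 3 * r.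
Proof.
move=> ab b1 /andP[r0 r1].
have -> : a^* ** a - b^* ** b = (a - b)^* ** (a - b) + (a - b)^* ** b + b^* ** (a - b).
  by rewrite !cstarE !cmulE; lmod.
have ab' : rnorm (a - b)^* <= r by rewrite rnorm_star.
have b1' : rnorm b^* <= 1 by rewrite rnorm_star.
have := rnormD_le (rnormD_le (rnormM_le ab' ab) (rnormM_le ab' b1)) (rnormM_le b1' ab).
by move=> /le_trans; apply; nra.
Qed.

Lemma rest_leading n i : m i = n -> ~ known n (src i) ->
  (if i is inr w then dead w else True) ->
  rnorm ((eta ^+ n)^-1%:C *: rest n -
    (match i with inl e => s e | inr w => p w end)) <= 2 * eta.
Proof.
move=> mi ki iv; pose f := selected p s eta m (fun u => ~ known n u).
have fd : dominated eta m f by exact: (selected_dominated hCK m eta0).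
have -> : rest n = f i + csum m (fun j => if `[< j = i >] then 0 else f j).
  exact: (csumD1 eta0 eta2 m_inj i fd).
have -> : f i = (eta ^+ n)%:C *: match i with inl e => s e | inr w => p w end.
  rewrite /f /selected asboolT// /summand -mi.
  by case: i iv {mi ki} => //= w dw; rewrite asboolT.
rewrite scalerDr scalerA -rmorphM mulVf ?gt_eqF// scale1r addrAC subrr add0r.
rewrite rnormZ gtr0_norm ?invr_gt0// ler_pdivrMl//.
have := @csum_norm _ _ _ _ _ eta0 eta2 (fun j => if `[< j = i >] then 0 else f j) 1 n.+1.
rewrite mulr1 exprS mulrA [_ * (_ * eta)]mulrC; apply=> //.
- move=> j; case: asboolP => _; last exact: (selected_norm hCK m eta0).
  by rewrite rnorm0 mul1r ltW.
- move=> j; rewrite ltnS leq_eqVlt => /predU1P[jn|jn].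
    by rewrite asboolT//; apply: m_inj; rewrite jn.
  case: asboolP => // _; rewrite /f /selected; case: asboolP => // kj.
  rewrite /summand; case: j jn kj => [e|w] jn kj.
    by case: kj; exists (inl e).
  by case: asboolP => // dw; case: kj; exists (inr w).
Qed.

Lemma near_perturb a b : rnorm (a - b) <= 2 * eta -> rnorm b <= 1 ->
  rnorm (a + a ** diag - b) <= 5 * eta.
Proof.
move=> ab b1; have a2 : rnorm a <= 2 * eta + 1.
  by rewrite -(subrK b a); apply: rnormD_le.
have -> : a + a ** diag - b = (a - b) + a ** diag by lmod.
apply: le_trans (rnormD_le ab (rnormM_le a2 diag_norm)) _.
by have := eta6; have := eta0; nra.
Qed.

Let eta5 : 0 <= 5 * eta <= 1.
Proof. by have := eta6; have := eta0; lra. Qed.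

Lemma rest_starM n t : ~ dead t -> ~ known n t ->
  (forall f, esource f = t -> ~ dead (erange f)) ->
  p t ** ((rest n)^* ** column p s eta m t) = (rest n)^* ** column p s eta m t.
Proof.
move=> nd kt nf; rewrite /column /part.
have fd := selected_dominated hCK m eta0 (eq^~ t).
rewrite (csum_mull eta0 eta2 _ fd) (csum_mull eta0 eta2); last first.
  apply: (csum_dominated_le (g := selected p s eta m (eq^~ t)) (C := rnorm (rest n)^*)) => //.
  - by move=> i; apply: rnormM.
  - exact: rnorm_ge0.
congr csum; apply/funext => -[f|w]; rewrite /selected /=; case: asboolP => [ft|_];
  rewrite ?cmul0r//; last by rewrite asboolF ?cmul0r// ft.
rewrite !cmulZr -[(rest n)^* ** s f]cstarK cstarM cstarK.
rewrite /rest (star_s_part hCK eta0 eta6 m_inj); last by move=> [/(nf f ft)].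
rewrite ft asboolT// cstarZr (CK_star_p hCK) cmulZr (CK_pp hCK) eqxx//.
Qed.

Lemma mem_leading n i : (forall u, known n u -> B (p u)) ->
  B (rest n + rest n ** diag) -> m i = n -> ~ known n (src i) ->
  (if i is inr w then dead w else True) -> B (p (src i)).
Proof.
move=> Bk Br mi ki iv; have rl := rest_leading mi ki iv.
set V := _ *: rest n in rl; have rp : rest n ** p (src i) = column p s eta m (src i).
  by rewrite (part_p hCK m eta0 eta6) asboolT.
have BV : B (V + V ** diag) by rewrite /V cmulZl -scalerDr; apply: BZ.
case: i mi ki iv rl rp => [e|w] mi ki iv rl rp /=; last first.
  have near := near_perturb rl (CK_norm_p hCK w).
  have Vw : V ** p w = p w.
    rewrite /V cmulZl rp (column_dead p s eta m_inj)//= mi scalerA -rmorphM mulVf ?gt_eqF//.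
    by rewrite scale1r.
  apply: (projection_mem BB Bs (CK_proj hCK w) BV).
    rewrite -cmulA cmulDl -cmulA diag_p cmulA Vw cmulDr (cmulA _ (p w)).
    by rewrite (CK_pp hCK) eqxx.
  by apply: le_trans near _; have := eta6; lra.
set t := esource e in ki rp *.
have sl : B (p t) \/ ~ exists2 f, esource f = t & dead (erange f).
  have [[f ft fd]|] := pselect (exists2 f, esource f = t & dead (erange f)); last by right.
  left; have [f' [f't f'd f'm]] := m_dead ft fd.
  have kf : known n (erange f') by exists (inr (erange f')); split=> //; rewrite -mi.
  have Bq := mem_q (Bk _ kf).
  have By : B (s f' + s f' ** diag).
    apply: (BZV (etaXC (m (inl f')))); rewrite scalerDr -cmulZl.
    have := BM Bq Br; rewrite cmulDr !cmulA (q_part hCK eta0 eta6 m_inj); last by move=> [].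
    by rewrite f't asboolT.
  have ys : s f' ** p t = s f' by rewrite (CK_sp hCK) f't eqxx.
  set y := s f' + _ in By.
  have yp : y ** p t = y by rewrite /y cmulDl -cmulA diag_p cmulA ys.
  have py : p t ** y^* = y^* by rewrite -(CK_star_p hCK) -cstarM yp.
  apply: (projection_mem BB Bs (CK_proj hCK t) (BM (Bs By) By)).
    by rewrite !cmulA py.
  have ss : (s f')^* ** s f' = p t by rewrite (CK_source hCK) f't.
  have near0 : rnorm (s f' - s f') <= 2 * eta.
    by rewrite subrr rnorm0 mulr_ge0// ltW.
  have := star_near (near_perturb near0 (CK_norm_s hCK f')) (CK_norm_s hCK f') eta5.
  by rewrite ss => /le_trans; apply; have := eta6; lra.
case: sl => // nf.
have nd : ~ dead t by move=> /(_ e).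
have rs : p t ** (V^* ** (V ** p t)) = V^* ** (V ** p t).
  rewrite /V cstarZr !cmulZl rp !cmulZr rest_starM// => f ft fd.
  by apply: nf; exists f.
clearbody V; set N := V^* ** (V ** p t) in rs.
apply: (projection_mem BB Bs (CK_proj hCK t) (BM (Bs BV) BV)).
  have zE : (V + V ** diag)^* ** (V + V ** diag) ** p t =
      N + N ** diag + diag ** N + diag ** (N ** diag).
    rewrite -cmulA cmulDl -[V ** diag ** _]cmulA diag_p (cmulA V (p t)).
    by rewrite !cstarE diag_star /N !cmulE; lmod.
  have pN a : p t ** (N ** a) = N ** a by rewrite cmulA rs.
  have pd a : p t ** (diag ** a) = diag ** (p t ** a).
    by rewrite cmulA -diag_p cmulA.
  by rewrite -[RHS]cmulA zE !cmulDr !pd !pN rs.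
have ss : (s e)^* ** s e = p t by rewrite (CK_source hCK).
have := star_near (near_perturb rl (CK_norm_s hCK e)) (CK_norm_s hCK e) eta5.
by rewrite ss => /le_trans; apply; have := eta6; lra.
Qed.

Lemma rest_eq n n' : (forall u, known n u <-> known n' u) -> rest n = rest n'.
Proof.
move=> kn; rewrite /rest; congr part; apply/funext => u; apply/propext.
by rewrite (propext (kn u)).
Qed.

Lemma mem_induction n : (forall u, known n u -> B (p u)) /\ B (rest n + rest n ** diag).
Proof.
elim: n => [|n [Bk Br]].
  split=> [u [i []]//|]; suff -> : rest 0 = total by [].
  congr part; apply/funext => u; apply/propext; split=> // _ [i []//].
have [[i [mi ki iv]]|ni] := pselect (exists i, [/\ m i = n, ~ known n (src i) &
    (if i is inr w then dead w else True)]); last first.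
  have kn u : known n.+1 u <-> known n u.
    split=> [[i [iv]]|[i [iv im iu]]]; last by exists i; rewrite ltnW.
    rewrite ltnS leq_eqVlt => /predU1P[im iu|im iu]; last by exists i.
    by apply: contrapT => ku; apply: ni; exists i; rewrite iu.
  by rewrite (rest_eq kn); split=> // u /kn/Bk.
have Bi := mem_leading Bk Br mi ki iv.
have kn u : known n.+1 u <-> known n u \/ u = src i.
  split=> [[j [jv]]|[[j [jv jm ju]]|->]].
  - rewrite ltnS leq_eqVlt => /predU1P[jm ju|jm ju]; last by left; exists j.
    by right; rewrite -ju; congr src; apply: m_inj; rewrite jm.
  - by exists j; rewrite ltnW.
  - by exists i; rewrite mi ltnSn.
split=> [u /kn[/Bk//|->//]|].
have rE : rest n.+1 = rest n - rest n ** p (src i).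
  rewrite (part_p hCK m eta0 eta6) asboolT// /rest /column /part.
  rewrite -(csumB eta0 eta2) ?(selected_dominated hCK m eta0)//; last 2 first.
  - exact: (selected_dominated hCK m eta0).
  - exact: (selected_dominated hCK m eta0).
  congr csum; apply/funext => j; rewrite /selected.
  have [kj|kj] := pselect (known n.+1 (src j)).
    rewrite asboolF; last by move=> /(_ kj).
    move/kn: kj => [kj|ji]; last by rewrite ji !asboolT// subrr.
    rewrite asboolF; last by move=> /(_ kj).
    by rewrite asboolF ?subrr//= => ji; apply: ki; rewrite -ji.
  rewrite asboolT// asboolT; last by move=> k; apply/kj/kn; left.
  by rewrite asboolF ?subr0//= => ji; apply/kj/kn; right.
have -> : rest n.+1 + rest n.+1 ** diag =
    (rest n + rest n ** diag) - (rest n + rest n ** diag) ** p (src i).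
  have dp : rest n ** diag ** p (src i) = rest n ** p (src i) ** diag.
    by rewrite -!cmulA diag_p.
  by rewrite rE !cmulE dp; lmod.
by apply/BS/BM.
Qed.

Lemma mem_p u : B (p u).
Proof.
have [ud|und] := pselect (dead u).
  have [+ _] := mem_induction (m (inr u)).+1; apply.
  by exists (inr u); rewrite ltnSn.
have [e eu] : exists e, esource e = u.
  by apply: contrapT => neu; apply: und => e eu; apply: neu; exists e.
have [+ _] := mem_induction (m (inl e)).+1; apply.
by exists (inl e); rewrite ltnSn.
Qed.

Lemma mem_diag : B diag.
Proof.
apply: (csum_mem eta0 eta2 B0 BD _ diag_dominated); first by case: BB.
by move=> e; apply/BZ/mem_q/mem_p.
Qed.

Lemma mem_of_perturb a : B (a + a ** diag) -> B a.
Proof.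
move=> Ba; case: (BB) => _ _ _ _; apply => r r0.
pose d := fix d n := if n is n'.+1 then - (d n' ** diag) else a.
have [|n nr] := geometric_small (rnorm a) (_ : 0 <= 2^-1 <= 2^-1) r0.
  by rewrite lexx invr_ge0 ler0n.
have dn k : B (a - d k) /\ rnorm (d k) <= rnorm a * 2^-1 ^+ k.
  elim: k => [|k [Bd dk]]; first by rewrite /= subrr expr0 mulr1.
  split.
    have -> : a - d k.+1 = (a + a ** diag) - (a - d k) ** diag.
      by rewrite /= !cmulE; lmod.
    exact/BS/BM/mem_diag.
  rewrite /= rnormN exprSr mulrA; apply: rnormM_le => //.
  by apply: le_trans diag_norm _; have := eta6; lra.
exists (a - d n); first by case: (dn n).
have -> : a - (a - d n) = d n by lmod.
by case: (dn n) => _ /le_trans; apply; apply: nr.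
Qed.

Lemma mem_s e : B (s e).
Proof.
apply: mem_of_perturb; apply: (BZV (etaXC (m (inl e)))).
rewrite scalerDr -cmulZl.
have := BM (BM (mem_q (mem_p (erange e))) Bx) (mem_p (esource e)).
have dp : (total + total ** diag) ** p (esource e) =
    column p s eta m (esource e) + column p s eta m (esource e) ** diag.
  by rewrite cmulDl -cmulA diag_p cmulA total_p.
rewrite -cmulA dp cmulDr !cmulA (q_part hCK eta0 eta6 m_inj); first by rewrite asboolT.
by move=> [+ re]; rewrite re => /(_ e).
Qed.

End Membership.

Lemma cstar_subalgebra_closed (R : realType) (A : cstarAlgType R) (B : set A) :
  cstar_subalgebra B -> closed_subalgebra B.
Proof.
move=> [[B0 BD] BZ BM _ Bc]; split=> //.
by move=> a; apply: closed_approx.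
Qed.

Theorem mainTheorem2 (R : realType) (E : digraph) (A : cstarAlgType R)
    (p : vertex E -> A) (s : edge E -> A)
    (hCK : CK_family p s)
    (hgen : cstar_generated (range p `|` range s) = [set: A]) :
  exists x : A, cstar_generated [set x] = [set: A].
Proof.
have [m [m_inj m_dead]] := exists_order E.
have [eta [eta0 eta6]] : exists eta : R, 0 < eta /\ eta <= 1000^-1 * 1000^-1.
  exists (1000^-1 * 1000^-1); split; last exact: lexx.
  by apply: mulr_gt0; rewrite invr_gt0 ltr0n.
pose x := total p s eta m + total p s eta m ** diag s eta.
exists x; apply/seteqP; split=> // a _ B [BB xB].
have cB := cstar_subalgebra_closed BB.
have Bs y : B y -> B y^* by case: BB => _ _ _ Bs _; apply: Bs.
have Bx : B x by apply: xB.
have : cstar_generated (range p `|` range s) a by rewrite hgen.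
apply; split=> // _ [[v _ <-]|[e _ <-]].
- exact: (mem_p hCK eta0 eta6 m_inj m_dead cB Bs Bx).
- exact: (mem_s hCK eta0 eta6 m_inj m_dead cB Bs Bx).
Qed.
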